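(* Let $k$ be a field and let $\mathcal{D}=(G,\chi,z,\lambda,q)$ consist of a finite group $G$, a character $\chi\colon G\to k^{\times}$, a central element $z$ of $G$, and elements $q\in k^{\times}$ and $\lambda\in k$, such that - $q\chi(z)$ is a root of $1$ of order $n$ greater than $1$, - if $\lambda(z^n-1_G)\neq 0$ (in the group algebra $kG$), then $\chi^n=1$. Then $\mathcal{D}$ has associated a braided Hopf algebra $H_{\mathcal{D}}$, as follows. As an algebra, $H_{\mathcal{D}}$ is generated by the group $G$ and an element $x$ subject to the relations $x^n=\lambda(z^n-1_G)$ and $xg=\chi(g)gx$ for all $g\in G$ (together with the group relations of $G$). The coalgebra structure of $H_{\mathcal{D}}$ is determined by $$\Delta(g)=g\otimes g,\quad \epsilon(g)=1\ \text{ for } g\in G,\qquad \Delta(x)=1\otimes x+x\otimes z,\quad \epsilon(x)=0,$$ the braid $c_q$ of $H_{\mathcal{D}}$ is defined by $$c_q(gx^i\otimes hx^j)=q^{ij}\,hx^j\otimes gx^i,$$ and its antipode is given by $$S(gx^i)=(-1)^i(q\chi(z))^{\frac{i(i-1)}{2}}x^iz^{-i}g^{-1}.$$ Furthermore, as a vector space $H_{\mathcal{D}}$ has basis $\{gx^i: g\in G,\ 0\le i<n\}$, and consequently $\dim(H_{\mathcal{D}})=n|G|$.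
   Context: All maps are $k$-linear, $\otimes=\otimes_k$, and the name of a space also denotes its identity map. For a map $c\colon V\otimes W\to W\otimes V$: if $V$ is an algebra, $c$ is compatible with it if $c\circ(\eta\otimes W)=W\otimes\eta$ and $c\circ(\mu\otimes W)=(W\otimes\mu)\circ(c\otimes V)\circ(V\otimes c)$; if $V$ is a coalgebra, $c$ is compatible with it if $(W\otimes\epsilon)\circ c=\epsilon\otimes W$ and $(W\otimes\Delta)\circ c=(c\otimes V)\circ(V\otimes c)\circ(\Delta\otimes W)$; similarly on the side of $W$. A braided bialgebra is a vector space $H$ with an algebra structure, a coalgebra structure and a bijective solution $c\in\mathrm{Aut}_k(H\otimes H)$ of the braid equation (called the braid), compatible (on both sides) with the algebra and coalgebra structures of $H$, such that $\eta$ is a coalgebra morphism, $\epsilon$ is an algebra morphism and $\Delta\circ\mu=(\mu\otimes\mu)\circ(H\otimes c\otimes H)\circ(\Delta\otimes\Delta)$. It is a braided Hopf algebra if the identity map of $H$ has an inverse $S$ for the convolution product; $S$ is the antipode. Because of the last identity, $\Delta$ and $\epsilon$ are determined by their values on algebra generators. *)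

(* Defs.v *)
From HB Require Import structures.
From mathcomp Require Import all_boot all_fingroup all_algebra all_solvable.
From mathcomp Require Import finmap boolp generic_quotient.
From mathcomp.multinomials Require Import monalg.

Set Implicit Arguments.
Unset Strict Implicit.
Unset Printing Implicit Defensive.

Import GRing.Theory.
Local Open Scope ring_scope.

Reserved Notation "V ⊗ W" (at level 40, left associativity).
Reserved Notation "v \ox w" (at level 40, left associativity).

(* The quotient of a module by the submodule spanned by R is taken along *)
(* the classical boolean reflection of membership in that span.          *)

Inductive lspan (k : nzRingType) (V : lmodType k) (R : V -> Prop) : V -> Prop :=
| lspan_gen v of R v : lspan R v
| lspan0 : lspan R 0
| lspanD u v of lspan R u & lspan R v : lspan R (u + v)
| lspanZ a v of lspan R v : lspan R (a *: v).

Section QuotientModule.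
Context (k : nzRingType) (V : lmodType k) (R : V -> Prop).
Implicit Types (u v : V).

Lemma lspanN v : lspan R v -> lspan R (- v).
Proof. by rewrite -scaleN1r; apply: lspanZ. Qed.

Definition qmod_rel u v : bool := `[< lspan R (u - v) >].

Fact qmod_rel_equiv : equiv_class_of qmod_rel.
Proof.
split=> [v|u v|v u w].
- by apply/asboolP; rewrite subrr; apply: lspan0.
- by apply/asboolP/asboolP => /lspanN; rewrite opprB.
- move=> /asboolP uv /asboolP vw; apply/asboolP.
  by rewrite -[u](subrK v) -addrA; apply: lspanD.
Qed.
Canonical qmod_equiv_rel := EquivRelPack qmod_rel_equiv.

Definition qmod : Type := {eq_quot qmod_rel}%qT.
HB.instance Definition _ := Choice.on qmod.
HB.instance Definition _ := EqQuotient.on qmod.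

Definition qpi : V -> qmod := \pi_qmod%qT.

Lemma qpiP u v : qpi u = qpi v <-> lspan R (u - v).
Proof.
by split=> [/eqP|uv]; [|apply/eqP]; rewrite [_ == _]eqmodE => *; apply/asboolP.
Qed.

Lemma qpi_repr (x : qmod) : qpi (repr x) = x.
Proof. exact: reprK. Qed.

Lemma qmodW (P : qmod -> Prop) : (forall v, P (qpi v)) -> forall x, P x.
Proof. by move=> Ppi x; rewrite -[x]qpi_repr. Qed.

Definition qmod_add (x y : qmod) : qmod := qpi (repr x + repr y).
Definition qmod_opp (x : qmod) : qmod := qpi (- repr x).
Definition qmod_scale (a : k) (x : qmod) : qmod := qpi (a *: repr x).

Lemma qmod_addE u v : qmod_add (qpi u) (qpi v) = qpi (u + v).
Proof.
apply/qpiP; rewrite opprD addrACA.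
by apply: lspanD; apply/qpiP; rewrite qpi_repr.
Qed.

Lemma qmod_oppE v : qmod_opp (qpi v) = qpi (- v).
Proof. by apply/qpiP; rewrite -opprD; apply/lspanN/qpiP; rewrite qpi_repr. Qed.

Lemma qmod_scaleE a v : qmod_scale a (qpi v) = qpi (a *: v).
Proof. by apply/qpiP; rewrite -scalerBr; apply/lspanZ/qpiP; rewrite qpi_repr. Qed.

Fact qmod_addA : associative qmod_add.
Proof. by do 3![elim/qmodW=> ?]; rewrite !qmod_addE addrA. Qed.
Fact qmod_addC : commutative qmod_add.
Proof. by do 2![elim/qmodW=> ?]; rewrite !qmod_addE addrC. Qed.
Fact qmod_add0 : left_id (qpi 0) qmod_add.
Proof. by elim/qmodW=> ?; rewrite !qmod_addE add0r. Qed.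
Fact qmod_addN : left_inverse (qpi 0) qmod_opp qmod_add.
Proof. by elim/qmodW=> ?; rewrite qmod_oppE qmod_addE addNr. Qed.

HB.instance Definition _ :=
  GRing.isZmodule.Build qmod qmod_addA qmod_addC qmod_add0 qmod_addN.

Fact qmod_scaleA a b x : qmod_scale a (qmod_scale b x) = qmod_scale (a * b) x.
Proof. by elim/qmodW: x => ?; rewrite !qmod_scaleE scalerA. Qed.
Fact qmod_scale1 : left_id 1 qmod_scale.
Proof. by elim/qmodW=> ?; rewrite !qmod_scaleE scale1r. Qed.
Fact qmod_scaleDr : right_distributive qmod_scale +%R.
Proof.
move=> a; do 2![elim/qmodW=> ?].
by rewrite [_ + _]qmod_addE !qmod_scaleE [RHS]qmod_addE scalerDr.
Qed.
Fact qmod_scaleDl x : {morph qmod_scale^~ x : a b / a + b}.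
Proof.
by elim/qmodW: x => v a b; rewrite !qmod_scaleE [RHS]qmod_addE scalerDl.
Qed.

HB.instance Definition _ := GRing.Zmodule_isLmodule.Build k qmod
  qmod_scaleA qmod_scale1 qmod_scaleDr qmod_scaleDl.

Fact qpi_is_linear : linear qpi.
Proof. by move=> a u v; rewrite -qmod_addE -qmod_scaleE. Qed.
HB.instance Definition _ := GRing.isLinear.Build k V qmod *:%R qpi qpi_is_linear.

Lemma qpi_eq0 v : R v -> qpi v = 0.
Proof. by move=> Rv; apply/qpiP; rewrite subr0; apply: lspan_gen. Qed.

Section Lift.
Context (W : lmodType k) (f : {linear V -> W}) (fR : forall v, R v -> f v = 0).

Lemma lspan_ker v : lspan R v -> f v = 0.
Proof.
elim=> [||u {}v _ fu _ fv|a {}v _ fv]; rewrite ?linear0 //.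
  by rewrite linearD fu fv addr0.
by rewrite linearZ /= fv scaler0.
Qed.

(* The hypothesis fR is an argument so that the lift is linear. *)
Definition qlift of (forall v, R v -> f v = 0) := fun x : qmod => f (repr x).

Lemma qliftE v : qlift fR (qpi v) = f v.
Proof.
apply/eqP; rewrite -subr_eq0 -linearB; apply/eqP/lspan_ker/qpiP.
by rewrite qpi_repr.
Qed.

Fact qlift_is_linear : linear (qlift fR).
Proof.
move=> a; do 2![elim/qmodW=> ?].
by rewrite -linearZ -linearD !qliftE linearP.
Qed.
HB.instance Definition _ :=
  GRing.isLinear.Build k qmod W *:%R (qlift fR) qlift_is_linear.
End Lift.
End QuotientModule.

(* {malg k[K]} is the free k-module on K. *)

Section FreeModule.
Context (k : nzRingType) (K : choiceType) (V : lmodType k) (h : K -> V).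

Definition mlift (m : {malg k[K]}) : V := \sum_(x <- msupp m) m@_x *: h x.

Lemma mliftEw (d : {fset K}) m :
  (msupp m `<=` d)%fset -> mlift m = \sum_(x <- d) m@_x *: h x.
Proof.
move=> le; rewrite /mlift (big_fset_incl _ le) //= => x _ /mcoeff_outdom ->.
by rewrite scale0r.
Qed.

Fact mlift_is_linear : linear mlift.
Proof.
move=> a m n; pose d := (msupp m `|` msupp n)%fset.
have dm : (msupp m `<=` d)%fset by apply: fsubsetUl.
have dn : (msupp n `<=` d)%fset by apply: fsubsetUr.
have dmn : (msupp (a *: m + n) `<=` d)%fset.
  by apply: fsubset_trans (msuppD_le _ _) (fsetSU _ (msuppZ_le _ _)).
rewrite (mliftEw dm) (mliftEw dn) (mliftEw dmn) scaler_sumr -big_split /=.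
by apply: eq_bigr => x _; rewrite mcoeffD mcoeffZ scalerDl scalerA.
Qed.
HB.instance Definition _ :=
  GRing.isLinear.Build k {malg k[K]} V *:%R mlift mlift_is_linear.

Lemma mliftU x : mlift << x >> = h x.
Proof. by rewrite (mliftEw msuppU_le) big_seq_fset1 mcoeffUU scale1r. Qed.
End FreeModule.

Fact bilinear_forI (k : nzRingType) (U V W : lmodType k) (f : U -> V -> W) :
    (forall a u u' v, f (a *: u + u') v = a *: f u v + f u' v) ->
    (forall a u v v', f u (a *: v + v') = a *: f u v + f u v') ->
  bilinear_for *:%R *:%R f.
Proof. by move=> fl fr; split=> [v a u u'|u a v v']; rewrite ?fl ?fr. Qed.

Section Tensor.
Context (k : fieldType).

(* A tensor product of V and W: a module with a bilinear map from V and *)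
(* W, generated by the values of this map, through which every bilinear *)
(* map factors. These properties determine it up to a unique            *)
(* isomorphism, and V ⊗ W below is an opaque instance of this record.   *)
Record tensor_product (V W : lmodType k) := TensorProduct {
  tp_module : lmodType k;
  tp_tens : {bilinear V -> W -> tp_module};
  tp_lift (U : lmodType k) :
    {bilinear V -> W -> U} -> {linear tp_module -> U};
  tp_liftE (U : lmodType k) (f : {bilinear V -> W -> U}) v w :
    tp_lift f (tp_tens v w) = f v w;
  tp_ind (P : tp_module -> Prop) :
    (forall v w, P (tp_tens v w)) -> P 0 ->
    (forall s t, P s -> P t -> P (s + t)) -> forall t, P t
}.

Section TensorDef.
Context (V W : lmodType k).

Inductive tensor_rel : {malg k[(V * W)%type]} -> Prop :=
| tensor_relDl v v' w :
    tensor_rel (<< (v + v', w) >> - << (v, w) >> - << (v', w) >>)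
| tensor_relDr v w w' :
    tensor_rel (<< (v, w + w') >> - << (v, w) >> - << (v, w') >>)
| tensor_relZl a v w : tensor_rel (<< (a *: v, w) >> - a *: << (v, w) >>)
| tensor_relZr a v w : tensor_rel (<< (v, a *: w) >> - a *: << (v, w) >>).

Definition qtensor : Type := qmod tensor_rel.
HB.instance Definition _ := GRing.Lmodule.on qtensor.

Definition pure (v : V) (w : W) : qtensor := qpi tensor_rel << (v, w) >>.

Lemma pureDl w : {morph pure^~ w : v v' / v + v'}.
Proof.
move=> v v'; apply/eqP; rewrite -subr_eq0 opprD addrA; apply/eqP.
by have /qpi_eq0 := tensor_relDl v v' w; rewrite !linearB.
Qed.

Lemma pureDr v : {morph pure v : w w' / w + w'}.
Proof.
move=> w w'; apply/eqP; rewrite -subr_eq0 opprD addrA; apply/eqP.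
by have /qpi_eq0 := tensor_relDr v w w'; rewrite !linearB.
Qed.

Lemma pureZl a v w : pure (a *: v) w = a *: pure v w.
Proof.
apply/eqP; rewrite -subr_eq0; apply/eqP.
by have /qpi_eq0 := tensor_relZl a v w; rewrite linearB linearZ.
Qed.

Lemma pureZr a v w : pure v (a *: w) = a *: pure v w.
Proof.
apply/eqP; rewrite -subr_eq0; apply/eqP.
by have /qpi_eq0 := tensor_relZr a v w; rewrite linearB linearZ.
Qed.

Fact pure_is_bilinear : bilinear_for *:%R *:%R pure.
Proof.
by split=> [w a v v'|v a w w']; rewrite ?(pureDl, pureZl) ?(pureDr, pureZr).
Qed.
HB.instance Definition _ :=
  bilinear_isBilinear.Build k V W qtensor *:%R *:%R pure pure_is_bilinear.

Lemma pure_ind (P : qtensor -> Prop) :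
    (forall v w, P (pure v w)) -> P 0 ->
    (forall s t, P s -> P t -> P (s + t)) -> forall t, P t.
Proof.
move=> Ptens P0 PD; elim/qmodW=> m.
rewrite [m]monalgE linear_sum /=; elim/big_ind: _ => // -[v w] _.
suff -> : << m@_(v, w) *g (v, w) >> = m@_(v, w) *: << (v, w) >> :> {malg k[(V * W)%type]}.
  by rewrite linearZ /= -[_ *: _]pureZl.
by apply/malgP=> p; rewrite mcoeffZ !mcoeffU mulrnAr mulr1.
Qed.

Section Lift.
Context (U : lmodType k) (f : {bilinear V -> W -> U}).

Fact tensor_rel_ker m : tensor_rel m -> mlift (fun p => f p.1 p.2) m = 0.
Proof.
case=> *; rewrite !linearB /= ?linearZ /= !mliftU /=.
- by rewrite linearDl -addrA -opprD subrr.
- by rewrite linearDr -addrA -opprD subrr.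
- by rewrite linearZl_LR scalerN subrr.
- by rewrite linearZr_LR scalerN subrr.
Qed.

Definition qtlift : {linear qtensor -> U} := qlift tensor_rel_ker.

Lemma qtliftE v w : qtlift (pure v w) = f v w.
Proof. by rewrite [LHS]qliftE; apply: mliftU. Qed.
End Lift.

Fact tensor_spec : tensor_product V W.
Proof. exact: (TensorProduct qtliftE pure_ind). Qed.

Definition tensor : lmodType k := tp_module tensor_spec.
Definition tens : {bilinear V -> W -> tensor} := tp_tens tensor_spec.
Definition tlift (U : lmodType k) :
  {bilinear V -> W -> U} -> {linear tensor -> U} := @tp_lift _ _ tensor_spec U.

Lemma tliftE (U : lmodType k) (f : {bilinear V -> W -> U}) v w :
  tlift f (tens v w) = f v w.
Proof. exact: tp_liftE. Qed.

Lemma tens_ind (P : tensor -> Prop) :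
    (forall v w, P (tens v w)) -> P 0 ->
    (forall s t, P s -> P t -> P (s + t)) -> forall t, P t.
Proof. exact: tp_ind. Qed.

Lemma tens_ext (U : lmodType k) (f g : {linear tensor -> U}) :
  (forall v w, f (tens v w) = g (tens v w)) -> f =1 g.
Proof.
move=> fg; elim/tens_ind=> // [|s t fs ft]; first by rewrite !linear0.
by rewrite !linearD fs ft.
Qed.
End TensorDef.
Arguments tens {V W}.

Local Notation "V ⊗ W" := (tensor V W).
Local Notation "v \ox w" := (tens v w) : ring_scope.

Section TensorMap.
Context (V W V' W' : lmodType k).
Context (f : {linear V -> V'}) (g : {linear W -> W'}).

Definition tmap_fun v w := f v \ox g w.
Fact tmap_is_bilinear : bilinear_for *:%R *:%R tmap_fun.
Proof.
by split=> [w a v v'|v a w w']; rewrite /tmap_fun linearP ?linearPl ?linearPr.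
Qed.
HB.instance Definition _ :=
  bilinear_isBilinear.Build k V W (V' ⊗ W') *:%R *:%R tmap_fun tmap_is_bilinear.

Definition tmap : {linear V ⊗ W -> V' ⊗ W'} := tlift tmap_fun.

Lemma tmapE v w : tmap (v \ox w) = f v \ox g w.
Proof. exact: tliftE. Qed.
End TensorMap.

Section TensorAssoc.
Context (U V W : lmodType k).

Definition assoc_fun1 w u v : U ⊗ (V ⊗ W) := u \ox (v \ox w).
Fact assoc1_is_bilinear w : bilinear_for *:%R *:%R (assoc_fun1 w).
Proof.
by split=> [v a u u'|u a v v']; rewrite /assoc_fun1 ?linearPl ?linearPr.
Qed.
HB.instance Definition _ w := bilinear_isBilinear.Build k U V (U ⊗ (V ⊗ W))
  *:%R *:%R (assoc_fun1 w) (assoc1_is_bilinear w).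

Definition assoc_fun t w := tlift (assoc_fun1 w) t.
Fact assoc_is_bilinear : bilinear_for *:%R *:%R assoc_fun.
Proof.
apply: bilinear_forI => [a t t' w|a t w w']; rewrite /assoc_fun ?linearP //.
elim/tens_ind: t => [u v||t t' IHt IHt'].
- by rewrite !tliftE /= /assoc_fun1 !linearPr.
- by rewrite !linear0 addr0.
- by rewrite !linearD IHt IHt' addrACA.
Qed.
HB.instance Definition _ := bilinear_isBilinear.Build k (U ⊗ V) W
  (U ⊗ (V ⊗ W)) *:%R *:%R assoc_fun assoc_is_bilinear.

Definition assoc : {linear (U ⊗ V) ⊗ W -> U ⊗ (V ⊗ W)} := tlift assoc_fun.

Lemma assocE u v w : assoc ((u \ox v) \ox w) = u \ox (v \ox w).
Proof. by rewrite [LHS]tliftE [LHS]tliftE. Qed.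

Definition assocI_fun1 u v w : (U ⊗ V) ⊗ W := (u \ox v) \ox w.
Fact assocI1_is_bilinear u : bilinear_for *:%R *:%R (assocI_fun1 u).
Proof.
by split=> [w a v v'|v a w w']; rewrite /assocI_fun1 ?linearPr ?linearPl.
Qed.
HB.instance Definition _ u := bilinear_isBilinear.Build k V W ((U ⊗ V) ⊗ W)
  *:%R *:%R (assocI_fun1 u) (assocI1_is_bilinear u).

Definition assocI_fun u t := tlift (assocI_fun1 u) t.
Fact assocI_is_bilinear : bilinear_for *:%R *:%R assocI_fun.
Proof.
apply: bilinear_forI => [a u u' t|a u t t']; rewrite /assocI_fun ?linearP //.
elim/tens_ind: t => [v w||t t' IHt IHt'].
- by rewrite !tliftE /= /assocI_fun1 !linearPl.
- by rewrite !linear0 addr0.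
- by rewrite !linearD IHt IHt' addrACA.
Qed.
HB.instance Definition _ := bilinear_isBilinear.Build k U (V ⊗ W)
  ((U ⊗ V) ⊗ W) *:%R *:%R assocI_fun assocI_is_bilinear.

Definition assocI : {linear U ⊗ (V ⊗ W) -> (U ⊗ V) ⊗ W} := tlift assocI_fun.

Lemma assocIE u v w : assocI (u \ox (v \ox w)) = (u \ox v) \ox w.
Proof. by rewrite [LHS]tliftE [LHS]tliftE. Qed.
End TensorAssoc.

Section TensorUnit.
Context (V : lmodType k).

Definition lunit_fun (a : k^o) (v : V) : V := a *: v.
Fact lunit_is_bilinear : bilinear_for *:%R *:%R lunit_fun.
Proof.
apply: bilinear_forI => [a b c v|a b u v]; rewrite /lunit_fun.
  by rewrite scalerDl scalerA.
by rewrite scalerDr !scalerA [b * a]mulrC.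
Qed.
HB.instance Definition _ :=
  bilinear_isBilinear.Build k k^o V V *:%R *:%R lunit_fun lunit_is_bilinear.

Definition lunit : {linear k^o ⊗ V -> V} := tlift lunit_fun.

Lemma lunitE (a : k^o) v : lunit (a \ox v) = a *: v.
Proof. exact: tliftE. Qed.

Definition runit_fun (v : V) (a : k^o) : V := a *: v.
Fact runit_is_bilinear : bilinear_for *:%R *:%R runit_fun.
Proof.
apply: bilinear_forI => [a u v b|a v b c]; rewrite /runit_fun.
  by rewrite scalerDr !scalerA [b * a]mulrC.
by rewrite scalerDl scalerA.
Qed.
HB.instance Definition _ :=
  bilinear_isBilinear.Build k V k^o V *:%R *:%R runit_fun runit_is_bilinear.

Definition runit : {linear V ⊗ k^o -> V} := tlift runit_fun.

Lemma runitE (a : k^o) v : runit (v \ox a) = a *: v.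
Proof. exact: tliftE. Qed.
End TensorUnit.

Section MulMap.
Context (A : algType k).

Definition mulmap_fun (a b : A) : A := a * b.
Fact mulmap_is_bilinear : bilinear_for *:%R *:%R mulmap_fun.
Proof.
apply: bilinear_forI => [c a b d|c a b d]; rewrite /mulmap_fun.
  by rewrite mulrDl scalerAl.
by rewrite mulrDr scalerAr.
Qed.
HB.instance Definition _ :=
  bilinear_isBilinear.Build k A A A *:%R *:%R mulmap_fun mulmap_is_bilinear.

Definition mulmap : {linear A ⊗ A -> A} := tlift mulmap_fun.

Lemma mulmapE a b : mulmap (a \ox b) = a * b.
Proof. exact: tliftE. Qed.
End MulMap.
End Tensor.

Arguments tens {k V W}.
Arguments assoc {k U V W}.
Arguments assocI {k U V W}.
Notation "V ⊗ W" := (tensor V W).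
Notation "v \ox w" := (tens v w) : ring_scope.

(* The free algebra on I, up to a unique isomorphism; free_alg below is *)
(* an opaque instance.                                                  *)
Record free_algebra (k : fieldType) (I : Type) := FreeAlgebra {
  fa_alg : algType k;
  fa_gen : I -> fa_alg;
  fa_lift (A : algType k) : (I -> A) -> {lrmorphism fa_alg -> A};
  fa_lift_gen (A : algType k) (f : I -> A) i : fa_lift f (fa_gen i) = f i;
  fa_ind (P : fa_alg -> Prop) :
    (forall i, P (fa_gen i)) -> P 1 ->
    (forall u v, P u -> P v -> P (u + v)) ->
    (forall u v, P u -> P v -> P (u * v)) ->
    (forall a u, P u -> P (a *: u)) -> forall u, P u
}.

Definition malg_free (k : fieldType) (I : choiceType) : Type :=
  {malg k[{fmonom I}]}.

Section FreeAlgebra.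
Context (k : fieldType) (I : choiceType).

HB.instance Definition _ := GRing.Lalgebra.on (malg_free k I).

Fact malg_free_scalerAr (a : k) (u v : malg_free k I) :
  a *: (u * v) = u * (a *: v).
Proof.
apply/malgP => m; rewrite mcoeffZ !(mcoeffMlw _ (fsubset_refl _) (d2 := msupp v)) //.
  rewrite mulr_sumr; apply: eq_bigr => i _; rewrite mulr_sumr.
  by apply: eq_bigr => j _; rewrite mcoeffZ mulrnAr mulrCA.
exact: msuppZ_le.
Qed.
HB.instance Definition _ :=
  GRing.Lalgebra_isAlgebra.Build k (malg_free k I) malg_free_scalerAr.

Definition malg_gen (i : I) : malg_free k I := << fmu i >>.

Section Lift.
Context (A : algType k) (f : I -> A).

Definition malg_lift_fun (u : malg_free k I) : A :=
  mlift (fun m : fmonom I => \prod_(i <- m : seq I) f i) u.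

Fact malg_lift_is_linear : linear malg_lift_fun.
Proof. exact: mlift_is_linear. Qed.
HB.instance Definition _ :=
  GRing.isLinear.Build k (malg_free k I) A *:%R malg_lift_fun malg_lift_is_linear.

Lemma malg_liftUZ c m :
  malg_lift_fun << c *g m >> = c *: \prod_(i <- m : seq I) f i.
Proof. by rewrite /malg_lift_fun (mliftEw _ msuppU_le) big_seq_fset1 mcoeffUU. Qed.

Fact malg_lift_is_monoid_morphism : monoid_morphism malg_lift_fun.
Proof.
split=> [|u v]; first by have := malg_liftUZ 1 (mone : fmonom I); rewrite scale1r fm1 big_nil.
rewrite [u * v]malgME linear_sum [malg_lift_fun u]/mlift mulr_suml.
apply: eq_bigr => a _; rewrite linear_sum mulr_sumr /=.
apply: eq_bigr => b _; rewrite malg_liftUZ.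
by rewrite -scalerAl -scalerAr scalerA [mmul a b]fmmulE big_cat.
Qed.
HB.instance Definition _ := GRing.isMonoidMorphism.Build (malg_free k I) A
  malg_lift_fun malg_lift_is_monoid_morphism.

Definition malg_lift : {lrmorphism malg_free k I -> A} := malg_lift_fun.

Lemma malg_lift_gen i : malg_lift (malg_gen i) = f i.
Proof. by rewrite [LHS]malg_liftUZ scale1r fmU big_seq1. Qed.
End Lift.

Lemma malg_free_ind (P : malg_free k I -> Prop) :
    (forall i, P (malg_gen i)) -> P 1 ->
    (forall u v, P u -> P v -> P (u + v)) ->
    (forall u v, P u -> P v -> P (u * v)) ->
    (forall a u, P u -> P (a *: u)) -> forall u, P u.
Proof.
move=> Pgen P1 PD PM PZ u.
have PU (m : fmonom I) : P << m >>.
  case: m => s; elim: s => [|i s IHs]; first by rewrite -fmoneE.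
  have -> : FMonom (i :: s) = mmul (fmu i) (FMonom s) by rewrite [RHS]fmmulE fmU.
  suff -> : << mmul (fmu i) (FMonom s) >> = malg_gen i * << FMonom s >>.
    exact: PM.
  by rewrite [RHS]fgmulUU mulr1.
rewrite [u]monalgE; elim/big_ind: _ => [|//|m _].
  by rewrite -(scale0r 1); apply: PZ.
suff -> : << u@_m *g m >> = u@_m *: << m >> :> malg_free k I by apply: PZ.
by apply/malgP=> p; rewrite mcoeffZ !mcoeffU mulrnAr mulr1.
Qed.

Fact free_algebra_spec : free_algebra k I.
Proof. exact: (FreeAlgebra malg_lift_gen malg_free_ind). Qed.

Definition free_alg : algType k := fa_alg free_algebra_spec.
Definition fgen : I -> free_alg := fa_gen free_algebra_spec.
Definition free_lift (A : algType k) (f : I -> A) :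
  {lrmorphism free_alg -> A} := fa_lift free_algebra_spec f.

Lemma free_lift_gen (A : algType k) (f : I -> A) i :
  free_lift f (fgen i) = f i.
Proof. exact: fa_lift_gen. Qed.

Lemma free_alg_ind (P : free_alg -> Prop) :
    (forall i, P (fgen i)) -> P 1 ->
    (forall u v, P u -> P v -> P (u + v)) ->
    (forall u v, P u -> P v -> P (u * v)) ->
    (forall a u, P u -> P (a *: u)) -> forall u, P u.
Proof. exact: fa_ind. Qed.
End FreeAlgebra.

Section QuotientAlgebra.
Context (k : fieldType) (A : algType k) (R : A -> Prop).

Definition ideal_gen (u : A) : Prop := exists a r b, R r /\ u = a * r * b.

Definition ideal_span : A -> Prop := lspan ideal_gen.

Lemma ideal_spanMl a u : ideal_span u -> ideal_span (a * u).
Proof.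
elim=> [_ [b [r [c [Rr ->]]]]||v w _ Iv _ Iw|c v _ Iv].
- by apply: lspan_gen; exists (a * b), r, c; rewrite !mulrA.
- by rewrite mulr0; apply: lspan0.
- by rewrite mulrDr; apply: lspanD.
- by rewrite -scalerAr; apply: lspanZ.
Qed.

Lemma ideal_spanMr a u : ideal_span u -> ideal_span (u * a).
Proof.
elim=> [_ [b [r [c [Rr ->]]]]||v w _ Iv _ Iw|c v _ Iv].
- by apply: lspan_gen; exists b, r, (c * a); rewrite !mulrA.
- by rewrite mul0r; apply: lspan0.
- by rewrite mulrDl; apply: lspanD.
- by rewrite -scalerAl; apply: lspanZ.
Qed.

Lemma ideal_span_ker (B : algType k) (f : {lrmorphism A -> B}) :
  (forall r, R r -> f r = 0) -> forall u, ideal_span u -> f u = 0.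
Proof.
move=> fR; apply: lspan_ker => _ [a [r [b [/fR fr0 ->]]]].
by rewrite !rmorphM /= fr0 mulr0 mul0r.
Qed.

(* The quotient of A by the two-sided ideal generated by R. *)
Record quotient_algebra := QuotientAlgebra {
  qa_alg : algType k;
  qa_pi : {lrmorphism A -> qa_alg};
  qa_surj : forall x, exists u, x = qa_pi u;
  qa_ker : forall u, qa_pi u = 0 <-> ideal_span u
}.

Section Construction.
Hypothesis (R_proper : ~ ideal_span 1).

Definition qalg of ~ ideal_span 1 : Type := qmod ideal_gen.
Local Notation Q := (qalg R_proper).
HB.instance Definition _ := GRing.Lmodule.on Q.

Definition qalg_pi : A -> Q := qpi ideal_gen.
Definition qalg_mul (x y : Q) : Q := qalg_pi (repr x * repr y).

Lemma qalg_mulE u v : qalg_mul (qalg_pi u) (qalg_pi v) = qalg_pi (u * v).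
Proof.
set u' := repr (qalg_pi u); set v' := repr (qalg_pi v).
have Iu : ideal_span (u' - u) by apply/qpiP; apply: qpi_repr.
have Iv : ideal_span (v' - v) by apply/qpiP; apply: qpi_repr.
apply/qpiP; have -> : u' * v' - u * v = (u' - u) * v' + u * (v' - v).
  by rewrite mulrBl mulrBr addrA subrK.
by apply: lspanD; [apply: ideal_spanMr | apply: ideal_spanMl].
Qed.

Lemma qalgW (P : Q -> Prop) : (forall u, P (qalg_pi u)) -> forall x, P x.
Proof. exact: qmodW. Qed.

Fact qalg_pi_is_linear : linear qalg_pi.
Proof. exact: qpi_is_linear. Qed.
HB.instance Definition _ :=
  GRing.isLinear.Build k A Q *:%R qalg_pi qalg_pi_is_linear.

Fact qalg_mulA : associative qalg_mul.
Proof. by do 3![elim/qalgW=> ?]; rewrite !qalg_mulE mulrA. Qed.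
Fact qalg_mul1 : left_id (qalg_pi 1) qalg_mul.
Proof. by elim/qalgW=> ?; rewrite qalg_mulE mul1r. Qed.
Fact qalg_mulr1 : right_id (qalg_pi 1) qalg_mul.
Proof. by elim/qalgW=> ?; rewrite qalg_mulE mulr1. Qed.
Fact qalg_mulDl : left_distributive qalg_mul +%R.
Proof.
do 3![elim/qalgW=> ?].
by rewrite -linearD !qalg_mulE mulrDl linearD.
Qed.
Fact qalg_mulDr : right_distributive qalg_mul +%R.
Proof.
do 3![elim/qalgW=> ?].
by rewrite -linearD !qalg_mulE mulrDr linearD.
Qed.
Fact qalg_1_neq0 : qalg_pi 1 != 0.
Proof.
apply/eqP => e; apply: R_proper; rewrite -[1]subr0; apply/qpiP.
exact: e.
Qed.

HB.instance Definition _ := GRing.Zmodule_isNzRing.Build Q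
  qalg_mulA qalg_mul1 qalg_mulr1 qalg_mulDl qalg_mulDr qalg_1_neq0.

Lemma qalg_piM u v : qalg_pi u * qalg_pi v = qalg_pi (u * v).
Proof. exact: qalg_mulE. Qed.

Lemma qalg_piZ a u : a *: qalg_pi u = qalg_pi (a *: u).
Proof. by rewrite linearZ. Qed.

Fact qalg_scalerAl (a : k) (x y : Q) : a *: (x * y) = a *: x * y.
Proof.
elim/qalgW: x => u; elim/qalgW: y => v.
by rewrite (qalg_piM u v) (qalg_piZ a u) (qalg_piZ a (u * v)) qalg_piM scalerAl.
Qed.
HB.instance Definition _ := GRing.Lmodule_isLalgebra.Build k Q qalg_scalerAl.

Fact qalg_scalerAr (a : k) (x y : Q) : a *: (x * y) = x * (a *: y).
Proof.
elim/qalgW: x => u; elim/qalgW: y => v.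
by rewrite (qalg_piM u v) (qalg_piZ a v) (qalg_piZ a (u * v)) qalg_piM scalerAr.
Qed.
HB.instance Definition _ := GRing.Lalgebra_isAlgebra.Build k Q qalg_scalerAr.

Fact qalg_pi_is_monoid_morphism : monoid_morphism qalg_pi.
Proof. by split=> // u v; rewrite qalg_piM. Qed.
HB.instance Definition _ :=
  GRing.isMonoidMorphism.Build A Q qalg_pi qalg_pi_is_monoid_morphism.

Fact quotient_algebra_spec : quotient_algebra.
Proof.
apply: (@QuotientAlgebra Q qalg_pi) => [x|u].
  by exists (repr x); rewrite [RHS]qpi_repr.
by rewrite -{2}[u]subr0 -[ideal_span _]/(lspan _ _) -qpiP.
Qed.
End Construction.
End QuotientAlgebra.

Definition is_basis (k : fieldType) (V : lmodType k) (I : finType)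
    (e : I -> V) : Prop :=
  (forall a : I -> k, \sum_i a i *: e i = 0 -> forall i, a i = 0) /\
  (forall v, exists a : I -> k, v = \sum_i a i *: e i).

Definition has_dim (k : fieldType) (V : lmodType k) (d : nat) : Prop :=
  exists e : 'I_d -> V, is_basis e.

(* Threefold tensor products are bracketed to the left: on (U ⊗ V) ⊗ W,  *)
(* tmap f idfun is f ⊗ W and on23 g is U ⊗ g up to associativity. The    *)
(* unit conditions of compatibility are written on elements, which       *)
(* identifies k ⊗ W and W ⊗ k with W.                                    *)

Section Braided.
Context (k : fieldType).

Definition on23 (U V W V' W' : lmodType k)
    (g : {linear V ⊗ W -> V' ⊗ W'}) (t : (U ⊗ V) ⊗ W) : (U ⊗ V') ⊗ W' :=
  assocI (tmap idfun g (assoc t)).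

Fact on23_is_linear (U V W V' W' : lmodType k)
  (g : {linear V ⊗ W -> V' ⊗ W'}) : linear (@on23 U V W V' W' g).
Proof. by move=> a s t; rewrite /on23 !linearP. Qed.
HB.instance Definition _ (U V W V' W' : lmodType k)
    (g : {linear V ⊗ W -> V' ⊗ W'}) :=
  GRing.isLinear.Build k ((U ⊗ V) ⊗ W) ((U ⊗ V') ⊗ W') *:%R
    (@on23 U V W V' W' g) (@on23_is_linear U V W V' W' g).

(* H ⊗ c ⊗ H *)
Definition middle (H : lmodType k) (c : {linear H ⊗ H -> H ⊗ H})
    (t : (H ⊗ H) ⊗ (H ⊗ H)) : (H ⊗ H) ⊗ (H ⊗ H) :=
  assoc (tmap (on23 c) idfun (assocI t)).

Definition braid_equation (H : lmodType k) (c : {linear H ⊗ H -> H ⊗ H}) :=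
  forall t : (H ⊗ H) ⊗ H,
    tmap c idfun (on23 c (tmap c idfun t)) =
    on23 c (tmap c idfun (on23 c t)).

Definition compat_algl (V : algType k) (W : lmodType k)
    (c : {linear V ⊗ W -> W ⊗ V}) : Prop :=
  (forall w, c (1 \ox w) = w \ox 1) /\
  (forall t : (V ⊗ V) ⊗ W,
     c (tmap (mulmap V) idfun t) =
     tmap idfun (mulmap V) (assoc (tmap c idfun (on23 c t)))).

Definition compat_algr (V : lmodType k) (W : algType k)
    (c : {linear V ⊗ W -> W ⊗ V}) : Prop :=
  (forall v, c (v \ox 1) = 1 \ox v) /\
  (forall t : (V ⊗ W) ⊗ W,
     c (tmap idfun (mulmap W) (assoc t)) =
     tmap (mulmap W) idfun (on23 c (tmap c idfun t))).

Definition compat_coalgl (V W : lmodType k)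
    (Delta : {linear V -> V ⊗ V}) (eps : {linear V -> k^o})
    (c : {linear V ⊗ W -> W ⊗ V}) : Prop :=
  (forall t, runit W (tmap idfun eps (c t)) = lunit W (tmap eps idfun t)) /\
  (forall t, assocI (tmap idfun Delta (c t)) =
             tmap c idfun (on23 c (tmap Delta idfun t))).

Definition compat_coalgr (V W : lmodType k)
    (Delta : {linear W -> W ⊗ W}) (eps : {linear W -> k^o})
    (c : {linear V ⊗ W -> W ⊗ V}) : Prop :=
  (forall t, lunit V (tmap eps idfun (c t)) = runit V (tmap idfun eps t)) /\
  (forall t, tmap Delta idfun (c t) =
             on23 c (tmap c idfun (assocI (tmap idfun Delta t)))).

Record is_coalgebra (H : lmodType k)
    (Delta : {linear H -> H ⊗ H}) (eps : {linear H -> k^o}) : Prop := {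
  coassoc : forall h,
    assoc (tmap Delta idfun (Delta h)) = tmap idfun Delta (Delta h);
  counitl : forall h, lunit H (tmap eps idfun (Delta h)) = h;
  counitr : forall h, runit H (tmap idfun eps (Delta h)) = h
}.

Record is_braided_bialgebra (H : algType k) (Delta : {linear H -> H ⊗ H})
    (eps : {linear H -> k^o}) (c : {linear H ⊗ H -> H ⊗ H}) : Prop := {
  bb_coalgebra : is_coalgebra Delta eps;
  bb_bijective : bijective c;
  bb_braid : braid_equation c;
  bb_compat_algl : compat_algl c;
  bb_compat_algr : compat_algr c;
  bb_compat_coalgl : compat_coalgl Delta eps c;
  bb_compat_coalgr : compat_coalgr Delta eps c;
  bb_Delta1 : Delta 1 = 1 \ox 1;
  bb_eps1 : eps 1 = 1;
  bb_epsM : forall a b : H, eps (a * b) = eps a * eps b;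
  bb_DeltaM : forall t : H ⊗ H,
    Delta (mulmap H t) =
    tmap (mulmap H) (mulmap H) (middle c (tmap Delta Delta t))
}.

(* S is a two-sided inverse of the identity for the convolution product  *)
(* f * g = mulmap \o tmap f g \o Delta.                                   *)
Definition is_antipode (H : algType k) (Delta : {linear H -> H ⊗ H})
    (eps : {linear H -> k^o}) (S : {linear H -> H}) : Prop :=
  (forall h, mulmap H (tmap S idfun (Delta h)) = (eps h : k)%:A) /\
  (forall h, mulmap H (tmap idfun S (Delta h)) = (eps h : k)%:A).

Record is_braided_hopf (H : algType k) (Delta : {linear H -> H ⊗ H})
    (eps : {linear H -> k^o}) (c : {linear H ⊗ H -> H ⊗ H})
    (S : {linear H -> H}) : Prop := {
  bh_bialgebra : is_braided_bialgebra Delta eps c;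
  bh_antipode : is_antipode Delta eps S
}.
End Braided.

Record hopf_datum (k : fieldType) (G : finGroupType) := HopfDatum {
  hd_chi : G -> k;
  hd_z : G;
  hd_lam : k;
  hd_q : k;
  hd_n : nat;
  hd_chi_neq0 : forall g, hd_chi g != 0;
  hd_chiM : forall g h, hd_chi (g * h)%g = hd_chi g * hd_chi h;
  hd_z_central : hd_z \in 'Z([set: G])%g;
  hd_q_neq0 : hd_q != 0;
  hd_qchi_order : hd_n.-primitive_root (hd_q * hd_chi hd_z);
  hd_n_gt1 : (1 < hd_n)%N;
  (* {malg k[G]} is the space underlying the group algebra kG. *)
  hd_lam_cond :
    hd_lam *: (<< (hd_z ^+ hd_n)%g >> - << 1%g >> : {malg k[G]}) != 0 ->
    forall g, hd_chi g ^+ hd_n = 1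
}.

Section HopfAlgebra.
Context (k : fieldType) (G : finGroupType) (D : hopf_datum k G).

Local Notation chi := (hd_chi D).
Local Notation z := (hd_z D).
Local Notation lam := (hd_lam D).
Local Notation n := (hd_n D).

(* The generators are Some g for g in G, and None for x. *)
Local Notation FA := (free_alg k (option G)).
Local Notation grp g := (@fgen k (option G) (Some g)).
Local Notation X := (@fgen k (option G) None).

Inductive HD_rel : FA -> Prop :=
| HD_rel1 : HD_rel (grp 1%g - 1)
| HD_relM g h : HD_rel (grp (g * h)%g - grp g * grp h)
| HD_relX : HD_rel (X ^+ n - lam *: (grp z ^+ n - 1))
| HD_relXg g : HD_rel (X * grp g - chi g *: (grp g * X)).

(* The free algebra maps onto k by g |-> 1, x |-> 0. *)
Fact HD_rel_proper : ~ ideal_span HD_rel 1.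
Proof.
have [eps [epsg epsx]] : exists eps : {lrmorphism FA -> k^o},
    (forall g, eps (grp g) = 1) /\ eps X = 0.
  pose f (i : option G) : k^o := if i is Some _ then 1 else 0.
  by exists (free_lift f); split=> [g|]; rewrite free_lift_gen.
have n_gt0 : (0 < n)%N by apply: ltnW (hd_n_gt1 D).
move=> /(@ideal_span_ker _ _ _ _ eps) e1; suff: eps 1 = 0.
  by rewrite rmorph1 => /eqP; rewrite oner_eq0.
apply: e1 => _ [|g h||g]; rewrite rmorphB /=.
- by rewrite epsg rmorph1 subrr.
- by rewrite rmorphM /= !epsg mulr1 subrr.
- rewrite rmorphXn linearZ rmorphB rmorphXn rmorph1 /= epsg epsx.
  by rewrite expr0n eqn0Ngt n_gt0 expr1n subrr scaler0 subrr.
- by rewrite rmorphM linearZ rmorphM /= epsx mul0r mulr0 scaler0 subrr.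
Qed.

Definition HD_quotient : quotient_algebra HD_rel :=
  quotient_algebra_spec HD_rel_proper.
Definition HD : algType k := qa_alg HD_quotient.
Definition HD_grp (g : G) : HD := qa_pi HD_quotient (grp g).
Definition HD_x : HD := qa_pi HD_quotient X.
End HopfAlgebra.

(* Main.v *)
From HB Require Import structures.
Require Import Defs.
From mathcomp Require Import all_boot all_fingroup all_algebra all_solvable.
From mathcomp Require Import ring boolp monalg.

(**
The vectors h x^i, with i < n, span because the relations move x to the right
of the group and lower x^n. They are independent because right multiplication
by g and x, written on the free module with basis G x {0, ..., n-1}, satisfies
the relations: whenever lambda (z^n - 1) <> 0 one has chi^n = 1. In all cases
lambda chi(z)^n = lambda q^n = lambda, so a linear map given on all h x^i is
well defined as soon as it respects h x^(i+n) = lambda (h z^n x^i - h x^i).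

Let tau scale h x^i by q^i, so that c(u (x) h x^j) = h x^j (x) tau^j u. Then
  Delta (u x) = M (Delta u),   M (u (x) v) = u (x) v x + u x (x) tau(v) z,
  S (u x) = - x z^-1 S (tau u),
and every axiom follows by induction on the degree from one commutation with M.
M = A + B with A B = q chi(z) B A, so M^n = A^n + B^n, because the Gaussian
binomials vanish at a primitive n-th root of unity; hence Delta respects the
relation for x^n. For S the needed sign is (-1)^n (q chi(z))^(n(n-1)/2) = -1.
*)

Set Implicit Arguments.
Unset Strict Implicit.
Unset Printing Implicit Defensive.

Import GRing.Theory.
Local Open Scope ring_scope.

(** * Gaussian binomial coefficients *)

Section QBinomial.
Context (R : comNzRingType) (q : R).

Fixpoint qbin (m j : nat) : R :=
  match m, j with
  | _, 0 => 1
  | 0, _.+1 => 0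
  | m'.+1, j'.+1 => qbin m' j' + q ^+ j'.+1 * qbin m' j'.+1
  end.

Arguments qbin : simpl never.

Lemma qbin0 m : qbin m 0 = 1.
Proof. by case: m. Qed.

Lemma qbinS m j : qbin m.+1 j.+1 = qbin m j + q ^+ j.+1 * qbin m j.+1.
Proof. by []. Qed.

Lemma qbin_small m j : (m < j)%N -> qbin m j = 0.
Proof.
elim: m j => [|m IHm] [|j] // mj.
by rewrite qbinS !IHm ?mulr0 ?addr0 // ltnW.
Qed.

Lemma qbin_diag m : qbin m m = 1.
Proof. by elim: m => // m IHm; rewrite qbinS IHm qbin_small // mulr0 addr0. Qed.

(** The absorption identity, stated without division so that it survives specialisation to a root of
    unity, where [1 - q ^+ j.+1] may vanish. *)
Lemma mul_qbin_diag m j :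
  (1 - q ^+ j.+1) * qbin m.+1 j.+1 = (1 - q ^+ m.+1) * qbin m j.
Proof.
elim: m j => [|m IHm] j.
  case: j => [|j]; rewrite qbinS; first by rewrite !qbin0 qbin_small ?mulr0 ?addr0.
  by rewrite !qbin_small // !mulr0 addr0 mulr0.
case: j => [|j].
  have := IHm 0; rewrite !qbinS !qbin0 => e.
  by rewrite [LHS]mulrDr [_ * (_ * _)]mulrCA e !exprS; ring.
have e0 := IHm j; have e1 := IHm j.+1; have eS := qbinS m j.
rewrite qbinS mulrDr mulrCA e1.
(* The Pascal rule and the induction hypothesis at [j] eliminate [qbin q m j.+1], leaving only
   multiples of [qbin q m.+1 j.+1]. *)
have -> : q ^+ j.+2 * ((1 - q ^+ m.+1) * qbin m j.+1) =
    q * ((1 - q ^+ m.+1) * qbin m.+1 j.+1 - (1 - q ^+ j.+1) * qbin m.+1 j.+1).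
  by rewrite e0 eS [q ^+ j.+2]exprS; ring.
by rewrite ![_ ^+ _.+2]exprS; ring.
Qed.

End QBinomial.
Arguments qbin : simpl never.

(** At [q ^+ n = 1] the right side of the absorption identity is zero, while [1 - q ^+ j] is not, as
    [n] does not divide [j]. *)
Lemma qbin_prim_root (R : idomainType) (q : R) n j :
  n.-primitive_root q -> (0 < j < n)%N -> qbin q n j = 0.
Proof.
move=> pq /andP[]; case: j => // j _ jn; case: n pq jn => // n pq jn.
have /eqP := mul_qbin_diag q n j.
rewrite (prim_expr_order pq) subrr mul0r mulf_eq0 subr_eq0 eq_sym.
by rewrite -(prim_order_dvd pq) gtnNdvd //= => /eqP.
Qed.

(** * Iterates of linear maps and the q-binomial theorem *)

Fact iter_is_linear (k : nzRingType) (V : lmodType k) m (f : {linear V -> V}) :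
  linear (iter m f).
Proof. by elim: m => [|m IHm] a u v //=; rewrite IHm linearP. Qed.
HB.instance Definition _ (k : nzRingType) (V : lmodType k) m (f : {linear V -> V}) :=
  GRing.isLinear.Build k V V *:%R (iter m f) (iter_is_linear m f).

Section QCommute.
Context (k : fieldType) (V : lmodType k) (A B : {linear V -> V}) (q : k).
Hypothesis AB : forall v, A (B v) = q *: B (A v).

Lemma qcomm_iter j v : A (iter j B v) = q ^+ j *: iter j B (A v).
Proof.
elim: j => [|j IHj] /=; first by rewrite scale1r.
by rewrite AB IHj linearZ scalerA -exprS.
Qed.

(** The q-binomial theorem with all factors [B] moved to the left: [A] passes [iter j B] at the cost
    of [q ^+ j], which is the weight in the Pascal rule. *)
Lemma iter_qcommD m v :
  iter m (fun u => A u + B u) v =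
  \sum_(j < m.+1) qbin q m j *: iter j B (iter (m - j) A v).
Proof.
elim: m => [|m IHm]; first by rewrite big_ord1 scale1r.
rewrite iterS IHm !linear_sum /= [RHS]big_ord_recl /= qbin0 scale1r.
rewrite [X in _ = _ + X](_ : _ =
    \sum_(i < m.+1) qbin q m i *: iter i.+1 B (iter (m - i) A v) +
    \sum_(i < m) (q ^+ i.+1 * qbin q m i.+1) *: iter i.+1 B (iter (m - i) A v));
  last first.
  (* The extra summand at [i = m] is zero, so both sums run over the same range and the Pascal rule
     applies termwise. *)
  rewrite [X in _ + X](_ : _ = \sum_(i < m.+1)
      (q ^+ i.+1 * qbin q m i.+1) *: iter i.+1 B (iter (m - i) A v)); last first.
    by rewrite big_ord_recr /= qbin_small // mulr0 scale0r addr0.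
  rewrite -big_split; apply: eq_bigr => i _.
  by rewrite /bump add1n qbinS scalerDl subSS.
rewrite addrCA [LHS]addrC; congr (_ + _).
  by apply: eq_bigr => i _; rewrite linearZ.
rewrite big_ord_recl qbin0 scale1r subn0 /=; congr (_ + _).
apply: eq_bigr => i _; rewrite /bump /= add1n add0n linearZ /= AB qcomm_iter.
rewrite [B (_ *: _)]linearZ /= !scalerA -mulrA -exprS mulrC.
by rewrite -[A (iter _ A v)]iterS -subSn // subSS.
Qed.

Lemma iter_qcommD_prim n v : n.-primitive_root q ->
  iter n (fun u => A u + B u) v = iter n A v + iter n B v.
Proof.
move=> pq; have n_gt0 := prim_order_gt0 pq; rewrite iter_qcommD.
case: n pq n_gt0 => // n pq _.
rewrite big_ord_recl big_ord_recr /= big1 => [|i _].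
  by rewrite qbin0 /bump /= add1n qbin_diag !scale1r subnn add0r.
rewrite /bump /= qbin_prim_root ?scale0r // add1n ltnS.
exact: ltn_ord.
Qed.
End QCommute.

(** * Right multiplication, tensor maps and bases *)

Section RightMul.
Context (k : fieldType) (A : algType k) (w : A).
Definition rmul (u : A) : A := u * w.
Fact rmul_is_linear : linear rmul.
Proof. by move=> a u v; rewrite /rmul mulrDl scalerAl. Qed.
HB.instance Definition _ := GRing.isLinear.Build k A A *:%R rmul rmul_is_linear.
End RightMul.

Lemma on23E (k : fieldType) (U V W V' W' : lmodType k)
    (f : {linear V ⊗ W -> V' ⊗ W'}) u v w :
  on23 f ((u \ox v) \ox w) = assocI (u \ox f (v \ox w)) :> (U ⊗ V') ⊗ W'.
Proof. by rewrite /on23 assocE tmapE. Qed.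

Lemma tmap_eq (k : fieldType) (V W V' W' : lmodType k)
    (f f' : {linear V -> V'}) (g g' : {linear W -> W'}) :
  f =1 f' -> g =1 g' -> tmap f g =1 tmap f' g'.
Proof. by move=> ff gg; apply: tens_ext => v w; rewrite !tmapE ff gg. Qed.

Lemma is_basis_dim (k : fieldType) (V : lmodType k) (I : finType) (e : I -> V) :
  is_basis e -> has_dim V #|I|.
Proof.
case=> e_free e_span; exists (fun i => e (enum_val i)); split=> [a a0 i|v].
  rewrite -[i]enum_valK; apply: (e_free (fun j => a (enum_rank j))).
  rewrite (reindex (enum_val : 'I_#|I| -> I)) /=; last exact/onW_bij/enum_val_bij.
  by rewrite -[RHS]a0; apply: eq_bigr => j _; rewrite enum_valK.
have [a ->] := e_span v; exists (fun i => a (enum_val i)).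
by rewrite (reindex (enum_val : 'I_#|I| -> I)) //=; apply/onW_bij/enum_val_bij.
Qed.

(** * The algebra and its basis *)

Section HopfDatum.
Context (k : fieldType) (G : finGroupType) (D : hopf_datum k G).

Local Notation chi := (hd_chi D).
Local Notation z := (hd_z D).
Local Notation lam := (hd_lam D).
Local Notation q := (hd_q D).
Local Notation n := (hd_n D).

Lemma hd_n_gt0 : (0 < n)%N.
Proof. exact: ltnW (hd_n_gt1 D). Qed.

Lemma hd_chi1 : chi 1%g = 1.
Proof.
apply: (mulfI (hd_chi_neq0 D 1%g)).
by rewrite -hd_chiM mulg1 mulr1.
Qed.

Lemma hd_chiX g m : chi (g ^+ m)%g = chi g ^+ m.
Proof.
elim: m => [|m IHm]; first by rewrite hd_chi1.
by rewrite expgS hd_chiM IHm exprS.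
Qed.

Lemma hd_zC g : (z * g = g * z)%g.
Proof. by have /centerP[_ /(_ g (in_setT g))] := hd_z_central D. Qed.

Lemma hd_zXC m g : (z ^+ m * g = g * z ^+ m)%g.
Proof. by apply/esym/commuteX/esym/hd_zC. Qed.

(** If [lam] is nonzero and [z ^+ n] differs from 1, the coefficient at [z ^+ n] shows that the
    group algebra element in the hypothesis is nonzero. *)
Lemma hd_lam_cases : [\/ lam = 0, (z ^+ n = 1)%g | forall g, chi g ^+ n = 1].
Proof.
have [-> | lam_neq0] := eqVneq lam 0; first exact: Or31.
have [-> | zn_neq1] := eqVneq (z ^+ n)%g 1%g; first exact: Or32.
apply: Or33; apply: (@hd_lam_cond _ _ D); rewrite scaler_eq0 (negPf lam_neq0) /=.
apply/eqP => /(congr1 (mcoeff (z ^+ n)%g)).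
rewrite mcoeffB !mcoeffU mcoeff0 eqxx eq_sym (negPf zn_neq1) subr0.
by move/eqP; rewrite oner_eq0.
Qed.

Lemma hd_lam_chizX : lam * chi z ^+ n = lam.
Proof.
have [->|zn1|->] := hd_lam_cases; rewrite ?mul0r ?mulr1 //.
by rewrite -hd_chiX zn1 hd_chi1 mulr1.
Qed.

(** Since [(q * chi z) ^+ n = 1], the absorption of [chi z ^+ n] by [lam] carries over to
    [q ^+ n]. *)
Lemma hd_lam_qX : lam * q ^+ n = lam.
Proof.
rewrite -[in LHS]hd_lam_chizX -mulrA -exprMn mulrC [chi z * q]mulrC.
by rewrite (prim_expr_order (hd_qchi_order D)) mul1r.
Qed.

(** This makes the braid with parameter [q^-1] available, which is the inverse of the braid with
    parameter [q]. *)
Lemma hd_lam_qVX : lam * q^-1 ^+ n = lam.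
Proof. by rewrite -[in LHS]hd_lam_qX exprVn mulfK // expf_neq0 // hd_q_neq0. Qed.

(* E h i plays the role of h x^i, but vanishes for n <= i. *)
Local Notation V := {ffun G * 'I_n -> k^o}.

Definition pbw_vec (h : G) (i : nat) : V :=
  [ffun p : G * 'I_n => ((p.1 == h) && (p.2 == i :> nat))%:R].
Local Notation E := pbw_vec.

Definition pbw_ext (f : G -> nat -> V) (v : V) : V := \sum_p v p *: f p.1 p.2.

Fact pbw_ext_is_linear f : linear (pbw_ext f).
Proof.
move=> a u v; rewrite /pbw_ext scaler_sumr -big_split; apply: eq_bigr => p _.
by rewrite /= !ffunE scalerDl scalerA.
Qed.
HB.instance Definition _ f :=
  GRing.isLinear.Build k V V *:%R (pbw_ext f) (pbw_ext_is_linear f).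

Lemma pbw_extE f h i : (i < n)%N -> pbw_ext f (E h i) = f h i.
Proof.
move=> lt_in; rewrite /pbw_ext (bigD1 (h, Ordinal lt_in)) //= ffunE !eqxx scale1r.
rewrite big1 ?addr0 // => -[g j]; rewrite xpair_eqE ffunE /= -val_eqE /=.
by move=> /negPf ->; rewrite scale0r.
Qed.

Lemma pbw_coef (a : G * 'I_n -> k) p : (\sum_r a r *: E r.1 r.2) p = a p.
Proof.
rewrite sum_ffunE (bigD1 p) //= !ffunE !eqxx.
rewrite big1 ?addr0 /= => [|r]; first exact: mulr1.
rewrite [r]surjective_pairing [p]surjective_pairing xpair_eqE -val_eqE /= => /negPf rp.
by rewrite !ffunE /= eq_sym [_ == _ :> nat]eq_sym rp; exact: mulr0.
Qed.

Lemma pbw_vecE (v : V) : v = pbw_ext E v.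
Proof. by apply/ffunP => p; rewrite /pbw_ext pbw_coef. Qed.

(** * The representation by right multiplications *)

Definition pbw_g (g : G) := pbw_ext (fun h i => chi g ^+ i *: E (h * g)%g i).

(** The second branch matters only at [i = n.-1], where [x ^+ n] is replaced by [lam] times
    [z ^+ n - 1]. *)
Definition pbw_x := pbw_ext (fun h i =>
  if (i.+1 < n)%N then E h i.+1 else lam *: (E (h * z ^+ n)%g 0 - E h 0)).

HB.instance Definition _ g := GRing.Linear.on (pbw_g g).
HB.instance Definition _ := GRing.Linear.on pbw_x.

Fact pbw_dim_gt0 : (0 < dim V)%N.
Proof.
rewrite /dim /= muln_gt0; apply/andP; split=> //.
by apply/card_gt0P; exists (1%g, Ordinal hd_n_gt0).
Qed.

Definition pbw_end : algType k := lfun_algType pbw_dim_gt0.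
Local Notation EndV := pbw_end.

Definition pbw_eval (a : EndV) : V -> V := fun_of_lfun a.

(** The product of [pbw_end] is composition in reverse order, so right multiplications give a
    morphism of algebras and not an antimorphism. *)
Lemma pbw_evalM a b v : pbw_eval (a * b) v = pbw_eval b (pbw_eval a v).
Proof. exact: comp_lfunE. Qed.

Lemma pbw_eval1 v : pbw_eval 1 v = v.
Proof. exact: id_lfunE. Qed.

Lemma pbw_evalD a b v : pbw_eval (a + b) v = pbw_eval a v + pbw_eval b v.
Proof. exact: add_lfunE. Qed.

Lemma pbw_evalZ c a v : pbw_eval (c *: a) v = c *: pbw_eval a v.
Proof. exact: scale_lfunE. Qed.

Lemma pbw_evalB a b v : pbw_eval (a - b) v = pbw_eval a v - pbw_eval b v.
Proof. by rewrite pbw_evalD -scaleN1r pbw_evalZ scaleN1r. Qed.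

Lemma pbw_eval0 v : pbw_eval 0 v = 0.
Proof. by rewrite -(scale0r 0) pbw_evalZ scale0r. Qed.

Lemma pbw_eval_sum (I : Type) (r : seq I) (P : pred I) (F : I -> EndV) v :
  pbw_eval (\sum_(i <- r | P i) F i) v = \sum_(i <- r | P i) pbw_eval (F i) v.
Proof.
exact: (big_morph (pbw_eval^~ v) (fun a b => pbw_evalD a b v) (pbw_eval0 v)).
Qed.

Lemma pbw_evalX a m v : pbw_eval (a ^+ m) v = iter m (pbw_eval a) v.
Proof.
elim: m => [|m IHm]; first exact: pbw_eval1.
by rewrite exprSr pbw_evalM IHm.
Qed.

Lemma pbw_eval_eq0 (a : EndV) :
  (forall h i, (i < n)%N -> pbw_eval a (E h i) = 0) -> a = 0.
Proof.
move=> a0; apply/lfunP => v; rewrite [v]pbw_vecE linear_sum zero_lfunE.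
by rewrite big1 // => p _; rewrite linearZ /= [X in _ *: X](a0 _ _ (ltn_ord _)) scaler0.
Qed.

Definition pbw_rep : {lrmorphism free_alg k (option G) -> EndV} :=
  free_lift (fun i =>
    (if i is Some g then linfun (pbw_g g) else linfun pbw_x) : EndV).

Lemma pbw_repg g v : pbw_eval (pbw_rep (fgen k (Some g))) v = pbw_g g v.
Proof. by rewrite /pbw_rep free_lift_gen /pbw_eval lfunE. Qed.

Lemma pbw_repx v : pbw_eval (pbw_rep (fgen k None)) v = pbw_x v.
Proof. by rewrite /pbw_rep free_lift_gen /pbw_eval lfunE. Qed.

Lemma pbw_gE g h i : (i < n)%N -> pbw_g g (E h i) = chi g ^+ i *: E (h * g)%g i.
Proof. exact: pbw_extE. Qed.

Lemma pbw_xE h i : (i.+1 < n)%N -> pbw_x (E h i) = E h i.+1.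
Proof. by move=> lt_in; rewrite /pbw_x pbw_extE ?lt_in // ltnW. Qed.

Lemma pbw_xE_last h :
  pbw_x (E h n.-1) = lam *: (E (h * z ^+ n)%g 0 - E h 0).
Proof. by rewrite /pbw_x pbw_extE ?ltn_predL ?hd_n_gt0 // prednK ?hd_n_gt0 // ltnn. Qed.

Lemma pbw_xXE h i : (i < n)%N -> iter i pbw_x (E h 0) = E h i.
Proof.
elim: i => // i IHi lt_in; rewrite iterS IHi; last exact: ltnW.
exact: pbw_xE.
Qed.

Lemma pbw_gXE g m h i : (i < n)%N ->
  iter m (pbw_g g) (E h i) = chi g ^+ (i * m) *: E (h * g ^+ m)%g i.
Proof.
move=> lt_in; elim: m => [|m IHm]; first by rewrite muln0 scale1r mulg1.
by rewrite iterS IHm linearZ /= pbw_gE // scalerA -exprD -mulnSr -mulgA -expgSr.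
Qed.

Lemma pbw_xnE h i : (i < n)%N ->
  iter n pbw_x (E h i) = lam *: (E (h * z ^+ n)%g i - E h i).
Proof.
move=> lt_in; rewrite -(pbw_xXE _ lt_in) -iterD addnC iterD.
rewrite -[X in iter X _ (E h 0)](prednK hd_n_gt0) iterS.
rewrite pbw_xXE ?ltn_predL ?hd_n_gt0 // pbw_xE_last.
by rewrite linearZ linearB /= !pbw_xXE.
Qed.

Lemma pbw_rep_rel u : HD_rel D u -> pbw_rep u = 0.
Proof.
move=> Ru; apply: pbw_eval_eq0 => h i lt_in; case: Ru => [|g g'||g].
- rewrite rmorphB rmorph1 pbw_evalB pbw_eval1 pbw_repg pbw_gE //.
  by rewrite hd_chi1 expr1n scale1r mulg1 subrr.
- rewrite rmorphB rmorphM pbw_evalB pbw_evalM !pbw_repg !pbw_gE // linearZ /=.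
  by rewrite pbw_gE // hd_chiM exprMn scalerA mulgA subrr.
- rewrite rmorphB /= linearZ rmorphB rmorph1 !rmorphXn /= pbw_evalB pbw_evalZ.
  rewrite pbw_evalB pbw_eval1 !pbw_evalX (eq_iter pbw_repx) (eq_iter (pbw_repg z)).
  rewrite pbw_xnE // pbw_gXE // !scalerBr scalerA mulnC exprM.
  (* Moving [z ^+ n] past [x ^+ i] costs a power of [chi z ^+ n], which [lam] absorbs. *)
  suff -> : lam * (chi z ^+ n) ^+ i = lam by rewrite subrr.
  by elim: i {lt_in} => [|i IHi]; rewrite ?mulr1 // exprSr mulrA IHi hd_lam_chizX.
rewrite rmorphB /= linearZ !rmorphM /= pbw_evalB pbw_evalZ !pbw_evalM !pbw_repg !pbw_repx.
have [lt_iSn | le_niS] := ltnP i.+1 n.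
  by rewrite pbw_xE // !pbw_gE // [pbw_x (_ *: _)]linearZ /= pbw_xE // scalerA -exprS subrr.
(* The remaining case is the wrap-around in top degree. *)
have -> : i = n.-1.
  apply/eqP; rewrite eqn_leq -ltnS prednK ?hd_n_gt0 // lt_in.
  by rewrite -ltnS prednK ?hd_n_gt0.
rewrite pbw_xE_last [pbw_g _ _]linearZ linearB /= !pbw_gE ?ltn_predL ?hd_n_gt0 //.
rewrite [pbw_x (_ *: _)]linearZ /= pbw_xE_last !expr0 !scale1r !scalerA.
rewrite -exprS prednK ?hd_n_gt0 // -!mulgA -hd_zXC.
(* The two sides agree up to a factor [chi g ^+ n] on [lam] times a difference that vanishes when
   [z ^+ n = 1]. The three alternatives are exactly what removes this discrepancy. *)
have [->|->|->] := hd_lam_cases; rewrite ?mul1r ?mulr0 ?scale0r ?subrr //.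
by rewrite mul1g !subrr !scaler0 subrr.
Qed.

(** * Relations, monomials and spanning *)

Local Notation H := (HD D).
Local Notation gr := (HD_grp D).
Local Notation x := (HD_x D).
Local Notation pi := (qa_pi (HD_quotient D)).

Lemma HD_pi_rel u : HD_rel D u -> pi u = 0.
Proof.
move=> Ru; apply/qa_ker/lspan_gen; exists 1, u, 1.
by rewrite mul1r mulr1.
Qed.

Lemma HD_grp1 : gr 1%g = 1.
Proof.
by apply/eqP; rewrite -subr_eq0 -(rmorph1 pi) -rmorphB /= HD_pi_rel //; apply: HD_rel1.
Qed.

Lemma HD_grpM g h : gr (g * h)%g = gr g * gr h.
Proof.
by apply/eqP; rewrite -subr_eq0 -rmorphM -rmorphB /= HD_pi_rel //; apply: HD_relM.
Qed.

Lemma HD_grpX g m : gr (g ^+ m)%g = gr g ^+ m.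
Proof.
elim: m => [|m IHm]; first by rewrite HD_grp1.
by rewrite expgS HD_grpM IHm exprS.
Qed.

Lemma HD_xn : x ^+ n = lam *: (gr (z ^+ n)%g - 1).
Proof.
apply/eqP; rewrite HD_grpX -subr_eq0 -(rmorph1 pi) -!rmorphXn /= -rmorphB /=.
by rewrite -linearZ -rmorphB /= HD_pi_rel //; apply: HD_relX.
Qed.

Lemma HD_xg g : x * gr g = chi g *: (gr g * x).
Proof.
apply/eqP; rewrite -subr_eq0 -!rmorphM /= -linearZ -rmorphB /= HD_pi_rel //.
exact: HD_relXg.
Qed.

Lemma HD_xXg g i : x ^+ i * gr g = chi g ^+ i *: (gr g * x ^+ i).
Proof.
elim: i => [|i IHi]; first by rewrite scale1r mulr1 mul1r.
rewrite exprS -mulrA IHi -scalerAr [x * (_ * _)]mulrA HD_xg -scalerAl scalerA.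
by rewrite -exprSr -mulrA -exprS.
Qed.

(** The degree is not bounded by [n]: products and right multiplication by [x] then need no case
    distinction, and [HD_mon_wrap] lowers the degree when necessary. *)
Definition HD_mon (g : G) (i : nat) : H := gr g * x ^+ i.
Local Notation b := HD_mon.

Lemma HD_mon0 g : b g 0 = gr g.
Proof. by rewrite /b mulr1. Qed.

Lemma HD_mon10 : b 1%g 0 = 1.
Proof. by rewrite HD_mon0 HD_grp1. Qed.

Lemma HD_monM g h i j : b g i * b h j = chi h ^+ i *: b (g * h)%g (i + j).
Proof.
by rewrite /b mulrA -[_ * gr h]mulrA HD_xXg -scalerAr -scalerAl exprD HD_grpM !mulrA.
Qed.

Lemma HD_monS g i : b g i.+1 = b g i * x.
Proof. by rewrite /b exprSr mulrA. Qed.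

Lemma HD_mongM g h i : b (g * h)%g i = gr g * b h i.
Proof. by rewrite /b HD_grpM mulrA. Qed.

Lemma HD_mon_wrap g i : b g (i + n) = lam *: (b (g * z ^+ n)%g i - b g i).
Proof.
by rewrite /b addnC exprD mulrA HD_xn -scalerAr -scalerAl mulrBr mulr1 -HD_grpM mulrBl.
Qed.

(** The spanning property in the form of an induction principle: a linear statement need only be
    checked on monomials of degree below [n]. *)
Lemma HD_span_lin (P : H -> Prop) : P 0 ->
  (forall a u v, P u -> P v -> P (a *: u + v)) ->
  (forall g i, (i < n)%N -> P (b g i)) -> forall u, P u.
Proof.
move=> P0 PL Pb u.
have PD v w : P v -> P w -> P (v + w).
  by move=> Pv Pw; rewrite -[v]scale1r; apply: PL.
have PZ a v : P v -> P (a *: v).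
  by move=> Pv; rewrite -[_ *: _]addr0; apply: PL.
have PB v w : P v -> P w -> P (v - w).
  by move=> Pv Pw; rewrite addrC -scaleN1r; apply: PL.
have Pb_all g i : P (b g i).
  elim/ltn_ind: i g => i IHi g; have [|le_ni] := ltnP i n; first exact: Pb.
  rewrite -(subnK le_ni) HD_mon_wrap; apply/PZ/PB; apply: IHi;
    by rewrite ltn_subrL hd_n_gt0 (leq_trans hd_n_gt0).
have [v ->] := qa_surj u; rewrite -[pi v]mulr1 -HD_mon10.
suff: forall g i, P (pi v * b g i) by apply.
(* [Q w] says that right multiplication by [w] preserves the set of those [t] all of whose products
   [t * b g i] satisfy [P]. This is stable under products, so it can be proved by induction in the
   free algebra. *)
pose Q w := forall t, (forall g i, P (t * b g i)) -> forall g i, P (t * w * b g i).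
suff Qv : Q (pi v).
  by move=> g i; rewrite -[pi v]mul1r; apply: Qv => {}g {}i; rewrite mul1r.
elim/free_alg_ind: v => [[g|]||v w Qv Qw|v w Qv Qw|a v Qv] t Pt h i.
- by rewrite -mulrA -[pi _]/(gr g) -HD_mongM.
- rewrite -mulrA -[pi _]/x -[x]mul1r -HD_grp1 -[x]expr1 -/(b 1%g 1) HD_monM.
  by rewrite -scalerAr; apply: PZ.
- by rewrite rmorph1 mulr1.
- by rewrite rmorphD mulrDr mulrDl; apply: PD; [apply: Qv | apply: Qw].
- rewrite rmorphM /= [t * (_ * _)]mulrA.
  exact: (Qw _ (Qv _ Pt)).
- by rewrite linearZ /= -scalerAr -scalerAl; apply/PZ/Qv.
Qed.

Lemma HD_basis : is_basis (fun p : G * 'I_n => HD_grp D p.1 * HD_x D ^+ p.2).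
Proof.
split=> [a | u].
  pose w := \sum_(p : G * 'I_n)
    a p *: (fgen k (Some p.1) * fgen k None ^+ p.2) : free_alg k (option G).
  move=> a0; have /qa_ker/(ideal_span_ker pbw_rep_rel) w0 : pi w = 0.
    rewrite -a0 linear_sum; apply: eq_bigr => p _.
    by rewrite linearZ rmorphM rmorphXn.
  (* Applied to the vector that represents 1, each monomial returns its own basis vector, so a
     relation in the quotient becomes one in the free module. *)
  have aE : \sum_p a p *: pbw_vec p.1 p.2 = 0.
    rewrite -[RHS](pbw_eval0 (pbw_vec 1%g 0)) -w0 linear_sum pbw_eval_sum.
    apply: eq_bigr => p _; rewrite linearZ rmorphM rmorphXn /= pbw_evalZ.
    rewrite pbw_evalM pbw_evalX pbw_repg (eq_iter pbw_repx).
    by rewrite pbw_gE ?hd_n_gt0 // expr0 scale1r mul1g pbw_xXE.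
  by move=> p; rewrite -(pbw_coef a p) aE ffunE.
elim/HD_span_lin: u => [|c u v [a ->] [a' ->]|g i lt_in].
- by exists (fun=> 0); rewrite big1 // => p _; rewrite scale0r.
- exists (fun p => c * a p + a' p).
  rewrite scaler_sumr -big_split; apply: eq_bigr => p _ /=.
  by rewrite scalerDl scalerA.
exists (fun p => (p == (g, Ordinal lt_in))%:R).
rewrite (bigD1 (g, Ordinal lt_in)) //= eqxx scale1r big1 ?addr0 // => p /negPf ->.
by rewrite scale0r.
Qed.

(** * The braided Hopf structure *)

Definition HD_coord (u : H) : G * 'I_n -> k := projT1 (cid (HD_basis.2 u)).

Lemma HD_coordE u : u = \sum_p HD_coord u p *: b p.1 p.2.
Proof. by rewrite {1}(projT2 (cid (HD_basis.2 u))). Qed.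

Lemma HD_coord_uniq u (a : G * 'I_n -> k) : u = \sum_p a p *: b p.1 p.2 -> HD_coord u =1 a.
Proof.
rewrite {1}[u]HD_coordE => /eqP; rewrite -subr_eq0 -sumrB => /eqP ua p.
apply/eqP; rewrite -subr_eq0; apply/eqP.
apply: (HD_basis.1 (fun r => HD_coord u r - a r)).
by rewrite -[RHS]ua; apply: eq_bigr => r _; rewrite scalerBl.
Qed.

Section Fixed.
Context (V : lmodType k) (f : G -> nat -> V).

Definition HD_ext (u : H) : V := \sum_p HD_coord u p *: f p.1 p.2.

Fact HD_ext_is_linear : linear HD_ext.
Proof.
move=> a u v; rewrite /HD_ext scaler_sumr -big_split; apply: eq_bigr => p _ /=.
rewrite scalerA -scalerDl; congr (_ *: _); move: p; apply: HD_coord_uniq.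
rewrite {1}[u]HD_coordE {1}[v]HD_coordE scaler_sumr -big_split.
by apply: eq_bigr => p _ /=; rewrite scalerA -scalerDl.
Qed.
HB.instance Definition _ :=
  GRing.isLinear.Build k H V *:%R HD_ext HD_ext_is_linear.

Definition HD_wraps := forall g i,
  f g (i + n) = lam *: (f (g * z ^+ n)%g i - f g i).

(** [HD_ext] reads [f] only in degrees below [n]. The wrap condition carries the formula to all
    degrees by strong induction, because [HD_mon_wrap] has the same shape. *)
Lemma HD_extE g i : HD_wraps -> HD_ext (b g i) = f g i.
Proof.
move=> fW; elim/ltn_ind: i g => i IHi g; have [lt_in|le_ni] := ltnP i n.
  rewrite /HD_ext.
  have /HD_coord_uniq bE : b g i =
      \sum_(p : G * 'I_n) (p == (g, Ordinal lt_in))%:R *: b p.1 p.2.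
    rewrite (bigD1 (g, Ordinal lt_in)) //= eqxx scale1r big1 ?addr0 // => p /negPf ->.
    by rewrite scale0r.
  rewrite (bigD1 (g, Ordinal lt_in)) //= bE eqxx scale1r big1 ?addr0 // => p /negPf p_neq.
  by rewrite bE p_neq scale0r.
rewrite -(subnK le_ni) HD_mon_wrap fW linearZ linearB /= !IHi //;
  by rewrite ltn_subrL hd_n_gt0 (leq_trans hd_n_gt0).
Qed.
End Fixed.

(* Scaling the degree-i part by a^i respects x^n = lam (z^n - 1). *)
Definition deg_weight (a : k) := lam * a ^+ n = lam.

Definition HD_scal (a : k) := HD_ext (fun g i => a ^+ i *: b g i).
HB.instance Definition _ a := GRing.Linear.on (HD_scal a).

Lemma HD_scalE a g i : deg_weight a -> HD_scal a (b g i) = a ^+ i *: b g i.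
Proof.
move=> aW; rewrite /HD_scal HD_extE // => {}g {}i.
rewrite exprD HD_mon_wrap -scalerBr !scalerA; congr (_ *: _).
by rewrite -[in RHS]aW; ring.
Qed.

Lemma HD_scal_iter a m g i : deg_weight a ->
  iter m (HD_scal a) (b g i) = a ^+ (i * m) *: b g i.
Proof.
move=> aW; elim: m => [|m IHm]; first by rewrite muln0 scale1r.
by rewrite iterS IHm linearZ /= HD_scalE // scalerA -exprD -mulnSr.
Qed.

Lemma HD_scalM a u v : deg_weight a -> HD_scal a (u * v) = HD_scal a u * HD_scal a v.
Proof.
move=> aW.
elim/HD_span_lin: u => [|c u w Pu Pw|g i _]; first by rewrite mul0r !linear0 mul0r.
  by rewrite mulrDl -scalerAl !linearP /= mulrDl -scalerAl Pu Pw.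
elim/HD_span_lin: v => [|c v w Pv Pw|h j _]; first by rewrite mulr0 !linear0 mulr0.
  by rewrite mulrDr -scalerAr !linearP /= mulrDr -scalerAr Pv Pw.
rewrite HD_monM linearZ /= !HD_scalE // -scalerAl -scalerAr HD_monM !scalerA.
by rewrite exprD; congr (_ *: _); ring.
Qed.

(** In degree [i] the iterate multiplies by [(a ^+ n) ^+ i], which [lam] absorbs factor by
    factor. *)
Lemma HD_scal_wrap a u : deg_weight a ->
  lam *: iter n (HD_scal a) u = lam *: u.
Proof.
move=> aW; elim/HD_span_lin: u => [|c u v Pu Pv|h i _]; first by rewrite linear0.
  by rewrite linearP !scalerDr !(scalerA lam c) !(mulrC lam c) -!scalerA Pu Pv.
rewrite HD_scal_iter // scalerA mulnC exprM; congr (_ *: _).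
by elim: i => [|i IHi]; rewrite ?mulr1 // exprSr mulrA IHi.
Qed.

(** * The braid *)

Definition HD_braid_fun (a : k) (u v : H) : H ⊗ H :=
  HD_ext (fun h j => b h j \ox iter j (HD_scal a) u) v.

Fact HD_braid_is_bilinear a : bilinear_for *:%R *:%R (HD_braid_fun a).
Proof.
apply: bilinear_forI => [c u u' v|c u v v']; rewrite /HD_braid_fun ?linearP //.
rewrite /HD_ext scaler_sumr -big_split; apply: eq_bigr => p _ /=.
by rewrite linearP linearPr scalerDr !scalerA [c * _]mulrC.
Qed.
HB.instance Definition _ a := bilinear_isBilinear.Build k H H (H ⊗ H)
  *:%R *:%R (HD_braid_fun a) (HD_braid_is_bilinear a).

Definition HD_braid a : {linear H ⊗ H -> H ⊗ H} := tlift (HD_braid_fun a).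

Lemma HD_braidEr a u h j : deg_weight a ->
  HD_braid a (u \ox b h j) = b h j \ox iter j (HD_scal a) u.
Proof.
move=> aW; rewrite [LHS]tliftE [LHS]HD_extE // => {}h i.
(* The scalar [lam] is moved to the second tensor factor, where it absorbs the [n] additional
   iterations of the scaling. *)
rewrite HD_mon_wrap iterD linearZl_LR -linearZr_LR /= -[lam *: iter i _ _]linearZ.
by rewrite HD_scal_wrap // linearZ linearZr_LR linearBl.
Qed.

Lemma HD_braidE a g h i j : deg_weight a ->
  HD_braid a (b g i \ox b h j) = a ^+ (i * j) *: (b h j \ox b g i).
Proof. by move=> aW; rewrite HD_braidEr // HD_scal_iter // linearZr_LR. Qed.

(** The scalar [a ^+ (i * j)] is symmetric in the two degrees, so the scaling may act on either
    factor. Each compatibility axiom uses the reading that leaves the multiplied or comultiplied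
    factors arbitrary. *)
Lemma HD_braidEl a g i v : deg_weight a ->
  HD_braid a (b g i \ox v) = iter i (HD_scal a) v \ox b g i.
Proof.
move=> aW; elim/HD_span_lin: v => [|c u v Pu Pv|h j _].
- by rewrite !(linear0, linear0r, linear0l).
- by rewrite linearPr !linearP Pu Pv linearPl.
by rewrite HD_braidE // HD_scal_iter // linearZl_LR mulnC.
Qed.

Local Notation tau := (HD_scal q).
Local Notation c := (HD_braid q).
Local Notation Q := (q * chi z).
Local Notation qW := (hd_lam_qX : deg_weight q).

(** Monomials arise from group elements by repeated right multiplication by [x]; this is the
    induction on the degree. *)
Lemma HD_gen_ind (P : H -> Prop) : P 0 ->
  (forall a u v, P u -> P v -> P (a *: u + v)) ->
  (forall g, P (gr g)) -> (forall u, P u -> P (u * x)) -> forall u, P u.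
Proof.
move=> P0 PL Pg Px; apply: HD_span_lin => // g i _.
by elim: i => [|i IHi]; rewrite ?HD_mon0 // HD_monS; apply: Px.
Qed.

Lemma HD_scalg g : tau (gr g) = gr g.
Proof. by rewrite -HD_mon0 HD_scalE ?scale1r //; apply: qW. Qed.

Lemma HD_scalx u : tau (u * x) = q *: (tau u * x).
Proof.
rewrite HD_scalM; last exact: qW.
have {1}-> : x = b 1%g 1 by rewrite /b HD_grp1 mul1r.
rewrite HD_scalE; last exact: qW.
by rewrite /b HD_grp1 mul1r -scalerAr.
Qed.

Lemma HD_scalMg u g : tau (u * gr g) = tau u * gr g.
Proof. by rewrite HD_scalM ?HD_scalg //; apply: qW. Qed.

(** * The comultiplication *)

Lemma HD_grpC g : gr g * gr z = gr z * gr g.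
Proof. by rewrite -!HD_grpM hd_zC. Qed.

(** The effect of [x \ox gr z] on a second tensor factor: [tau] for passing [x], then multiplication
    by [gr z]. *)
Definition zscal : H -> H := rmul (gr z) \o tau.
HB.instance Definition _ := GRing.Linear.on zscal.

Lemma zscalE u : zscal u = tau u * gr z. Proof. by []. Qed.

(* Right multiplication by 1 (x) x + x (x) z in the braided tensor product. *)
(* Opaque, so that linearD does not split shiftx t into its two summands. *)
Fact shiftx_spec : {f : {linear H ⊗ H -> H ⊗ H} |
  forall t, f t = tmap idfun (rmul x) t + tmap (rmul x) zscal t}.
Proof. by exists (tmap idfun (rmul x) \+ tmap (rmul x) zscal). Qed.
Definition shiftx := sval shiftx_spec.

Lemma shiftx_tmap t : shiftx t = tmap idfun (rmul x) t + tmap (rmul x) zscal t.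
Proof. exact: (svalP shiftx_spec). Qed.

Lemma shiftxE u v : shiftx (u \ox v) = u \ox (v * x) + (u * x) \ox zscal v.
Proof. by rewrite shiftx_tmap !tmapE. Qed.

Definition HD_Delta : H -> H ⊗ H := HD_ext (fun g i => iter i shiftx (gr g \ox gr g)).
HB.instance Definition _ := GRing.Linear.on HD_Delta.
Local Notation Delta := HD_Delta.

Lemma iter_rmul (A : algType k) m (u w : A) : iter m (rmul w) u = u * w ^+ m.
Proof.
elim: m => [|m IHm]; first by rewrite mulr1.
by rewrite iterS IHm /rmul exprSr mulrA.
Qed.

Lemma iter_tmap (V W : lmodType k) (f : {linear V -> V}) (h : {linear W -> W}) m v w :
  iter m (tmap f h) (v \ox w) = iter m f v \ox iter m h w.
Proof. by elim: m => //= m ->; rewrite tmapE. Qed.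

Lemma iter_zscal m g : iter m zscal (gr g) = gr (g * z ^+ m)%g.
Proof.
elim: m => [|m IHm]; first by rewrite mulg1.
by rewrite iterS IHm zscalE HD_scalg -HD_grpM -mulgA -expgSr.
Qed.

(** The factor [q] comes from applying [tau] to a product with [x], and [chi z] from exchanging [x]
    and [gr z]. *)
Lemma tmap_qcomm t :
  tmap (rmul x) zscal (tmap idfun (rmul x) t) =
  (q * chi z) *: tmap idfun (rmul x) (tmap (rmul x) zscal t).
Proof.
elim/tens_ind: t => [u v||s t es et].
- rewrite !tmapE /= /rmul zscalE HD_scalx -scalerAl -mulrA HD_xg -scalerAr.
  by rewrite !linearZr_LR scalerA mulrA zscalE.
- by rewrite !linear0.
by rewrite !linearD /= es et.
Qed.

(** Only the two extreme terms of the q-binomial expansion survive, [g x^n] tensor [g z^n] and [g]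
    tensor [g x^n]. After [x^n] is replaced, the mixed terms cancel. *)
Lemma iter_shiftx_n g : iter n shiftx (gr g \ox gr g) =
  lam *: (gr (g * z ^+ n)%g \ox gr (g * z ^+ n)%g - gr g \ox gr g).
Proof.
have -> : iter n shiftx (gr g \ox gr g) = iter n
    (fun t => tmap (rmul x) zscal t + tmap idfun (rmul x) t) (gr g \ox gr g).
  by apply: eq_iter => t; rewrite shiftx_tmap addrC.
rewrite (iter_qcommD_prim tmap_qcomm _ (hd_qchi_order D)) !iter_tmap /=.
rewrite iter_zscal !iter_rmul HD_xn -!scalerAr linearZr_LR linearZl_LR -scalerDr.
rewrite !mulrBr !mulr1 -!HD_grpM linearBl linearBr /=; congr (_ *: _).
rewrite [iter _ _ _](_ : _ = gr g); last by elim: (n) => //= m ->.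
by rewrite addrA subrK.
Qed.

Lemma HD_DeltaE g i : Delta (b g i) = iter i shiftx (gr g \ox gr g).
Proof.
rewrite [LHS]HD_extE // => {}g {}i.
by rewrite iterD iter_shiftx_n linearZ linearB.
Qed.

Lemma HD_Deltag g : Delta (gr g) = gr g \ox gr g.
Proof. by rewrite -HD_mon0 HD_DeltaE HD_mon0. Qed.

Lemma HD_DeltaMx u : Delta (u * x) = shiftx (Delta u).
Proof.
elim/HD_span_lin: u => [|a u v eu ev|g i _].
- by rewrite mul0r !linear0.
- by rewrite mulrDl -scalerAl !linearP /= eu ev.
by rewrite -HD_monS !HD_DeltaE.
Qed.

Lemma HD_Deltax : Delta x = 1 \ox x + x \ox gr z.
Proof.
rewrite -[x in LHS]mul1r HD_DeltaMx -HD_grp1 HD_Deltag shiftxE.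
by rewrite zscalE HD_scalg HD_grp1 !mul1r.
Qed.

(** Right multiplication by [gr g \ox gr g] commutes with [shiftx] up to the factor [chi g], because
    [z] is central and [tau] fixes group elements. *)
Lemma HD_DeltaMg u g : Delta (u * gr g) = tmap (rmul (gr g)) (rmul (gr g)) (Delta u).
Proof.
elim/HD_gen_ind: u => [|a u v eu ev|h|u eu].
- by rewrite mul0r !linear0.
- by rewrite mulrDl -scalerAl !linearP /= eu ev.
- by rewrite -HD_grpM !HD_Deltag tmapE /= /rmul -!HD_grpM.
rewrite -mulrA HD_xg -scalerAr mulrA linearZ /= !HD_DeltaMx eu.
elim/tens_ind: (Delta u) => [v w||s t es et].
- rewrite tmapE !shiftxE !linearD /= !tmapE /= /rmul !zscalE HD_scalMg.
  rewrite -linearZr_LR -linearZl_LR -!mulrA HD_xg HD_grpC.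
  by rewrite -!scalerAr.
- by rewrite !linear0.
by rewrite !linearD /= es et.
Qed.

(** [Delta] preserves the weight: both summands of [shiftx] add one factor [x], and [gr z] has
    degree 0. *)
Lemma HD_Delta_scal u : Delta (tau u) = tmap tau tau (Delta u).
Proof.
elim/HD_gen_ind: u => [|a u v eu ev|h|u eu].
- by rewrite !linear0.
- by rewrite !linearP /= eu ev.
- by rewrite HD_scalg !HD_Deltag tmapE /= !HD_scalg.
rewrite HD_scalx linearZ /= !HD_DeltaMx eu.
elim/tens_ind: (Delta u) => [v w||s t es et].
- rewrite tmapE !shiftxE !linearD /= !tmapE /= !HD_scalx !zscalE HD_scalMg.
  by rewrite linearZl_LR linearZr_LR.
- by rewrite !linear0.
by rewrite !linearD /= es et.
Qed.

Lemma HD_Delta_zscal u : Delta (zscal u) = tmap zscal zscal (Delta u).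
Proof.
rewrite zscalE HD_DeltaMg HD_Delta_scal.
elim/tens_ind: (Delta u) => [v w||s t es et]; first by rewrite !tmapE.
  by rewrite !linear0.
by rewrite !linearD /= es et.
Qed.

(** * The counit and the coalgebra axioms *)

Definition HD_eps : H -> k^o := HD_ext (fun g i => (i == 0%N)%:R : k^o).
HB.instance Definition _ := GRing.Linear.on HD_eps.
Local Notation eps := HD_eps.

Lemma HD_epsE g i : eps (b g i) = (i == 0%N)%:R.
Proof.
rewrite [LHS]HD_extE // => {}g {}i.
(* Both sides of the wrap condition vanish: the values do not depend on the group element, and
   [i + n] is never 0. *)
by rewrite subrr scaler0 addn_eq0 [n == _]eqn0Ngt hd_n_gt0 andbF.
Qed.

Lemma HD_epsg g : eps (gr g) = 1.
Proof. by rewrite -HD_mon0 HD_epsE. Qed.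

Lemma HD_epsMx u : eps (u * x) = 0.
Proof.
elim/HD_span_lin: u => [|a u v eu ev|g i _].
- by rewrite mul0r linear0.
- by rewrite mulrDl -scalerAl linearP /= eu ev scaler0 addr0.
by rewrite -HD_monS HD_epsE.
Qed.

Lemma HD_epsMg u g : eps (u * gr g) = eps u.
Proof.
elim/HD_gen_ind: u => [|a u v eu ev|h|u eu].
- by rewrite mul0r.
- by rewrite mulrDl -scalerAl !linearP /= eu ev.
- by rewrite -HD_grpM !HD_epsg.
by rewrite -mulrA HD_xg -scalerAr mulrA linearZ /= !HD_epsMx scaler0.
Qed.

Lemma HD_epsM u v : eps (u * v) = eps u * eps v.
Proof.
elim/HD_gen_ind: v => [|a v w ev ew|h|v ev].
- by rewrite mulr0 linear0 mulr0.
- by rewrite mulrDr -scalerAr !linearP /= ev ew mulrDr -scalerAr.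
- by rewrite HD_epsMg HD_epsg mulr1.
by rewrite mulrA !HD_epsMx mulr0.
Qed.

Lemma HD_eps_scal u : eps (tau u) = eps u.
Proof.
elim/HD_gen_ind: u => [|a u v eu ev|h|u eu].
- by rewrite !linear0.
- by rewrite !linearP /= eu ev.
- by rewrite HD_scalg.
by rewrite HD_scalx linearZ /= !HD_epsMx scaler0.
Qed.

Lemma HD_eps_zscal u : eps (zscal u) = eps u.
Proof. by rewrite zscalE HD_epsMg HD_eps_scal. Qed.

(** Right multiplication by the iterated coproduct of [x], with summands 1 tensor 1 tensor [x], 1
    tensor [x] tensor [z], and [x] tensor [z] tensor [z]. *)
Fact shift2x_spec : {f : {linear H ⊗ (H ⊗ H) -> H ⊗ (H ⊗ H)} | forall u s,
  f (u \ox s) = u \ox shiftx s + (u * x) \ox tmap zscal zscal s}.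
Proof.
exists (tmap idfun shiftx \+ tmap (rmul x) (tmap zscal zscal)) => u s.
by rewrite /= !tmapE.
Qed.
Definition shift2x := sval shift2x_spec.

Lemma shift2xE u s :
  shift2x (u \ox s) = u \ox shiftx s + (u * x) \ox tmap zscal zscal s.
Proof. exact: (svalP shift2x_spec). Qed.

(** Both iterated coproducts turn right multiplication by [x] into [shift2x], so it suffices to
    compare them on group elements. *)
Lemma HD_coassoc u : assoc (tmap Delta idfun (Delta u)) = tmap idfun Delta (Delta u).
Proof.
have shiftl t : assoc (tmap Delta idfun (shiftx t)) = shift2x (assoc (tmap Delta idfun t)).
  elim/tens_ind: t => [v w||s t es et]; last first.
  - by rewrite !linearD es et.
  - by rewrite !linear0.
  rewrite shiftxE linearD !tmapE /= HD_DeltaMx.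
  elim/tens_ind: (Delta v) => [v1 v2||s t es et]; last first.
  - rewrite [shiftx _]linearD !linearDl /= addrACA [LHS]linearD es et.
    by rewrite [assoc (_ + _)]linearD [RHS]linearD.
  - by rewrite [shiftx _]linear0 !linear0l addr0 !linear0.
  rewrite shiftxE linearDl /= !linearD /= !assocE shift2xE shiftxE tmapE linearDr /=.
  by rewrite addrA.
have shiftr t : tmap idfun Delta (shiftx t) = shift2x (tmap idfun Delta t).
  elim/tens_ind: t => [v w||s t es et]; last first.
  - by rewrite !linearD /= es et.
  - by rewrite !linear0.
  by rewrite shiftxE linearD /= !tmapE /= HD_DeltaMx HD_Delta_zscal shift2xE.
elim/HD_gen_ind: u => [|a u v eu ev|h|u eu].
- by rewrite !linear0.
- by rewrite !linearP /= eu ev.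
- by rewrite HD_Deltag !tmapE /= HD_Deltag assocE.
by rewrite HD_DeltaMx shiftl shiftr eu.
Qed.

Lemma HD_counitl u : lunit H (tmap eps idfun (Delta u)) = u.
Proof.
elim/HD_gen_ind: u => [|a u v eu ev|h|u {2}<-].
- by rewrite !linear0.
- by rewrite !linearP /= eu ev.
- by rewrite HD_Deltag tmapE lunitE /= HD_epsg scale1r.
(* The induction hypothesis has replaced [u] on the right by its expression in [Delta u], so the
   claim makes sense for an arbitrary tensor in place of [Delta u]. *)
rewrite HD_DeltaMx; elim/tens_ind: (Delta u) => [v w||s t es et].
- by rewrite shiftxE linearD /= !tmapE linearD /= !lunitE /= HD_epsMx scale0r addr0 scalerAl.
- by rewrite !linear0 mul0r.
by rewrite !linearD /= es et mulrDl.
Qed.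

Lemma HD_counitr u : runit H (tmap idfun eps (Delta u)) = u.
Proof.
elim/HD_gen_ind: u => [|a u v eu ev|h|u {2}<-].
- by rewrite !linear0.
- by rewrite !linearP /= eu ev.
- by rewrite HD_Deltag tmapE runitE /= HD_epsg scale1r.
rewrite HD_DeltaMx; elim/tens_ind: (Delta u) => [v w||s t es et].
- rewrite shiftxE linearD /= !tmapE linearD /= !runitE /= HD_epsMx HD_eps_zscal.
  by rewrite scale0r add0r scalerAl.
- by rewrite !linear0 mul0r.
by rewrite !linearD /= es et mulrDl.
Qed.

(** * The axioms of the braid *)

Lemma HD_tens_span (P : H ⊗ H -> Prop) : P 0 ->
  (forall a s t, P s -> P t -> P (a *: s + t)) ->
  (forall g i h j, P (b g i \ox b h j)) -> forall t, P t.
Proof.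
move=> P0 PL Pb; elim/tens_ind=> // [u v|s t Ps Pt]; last first.
  by rewrite -[s]scale1r; apply: PL.
elim/HD_span_lin: u => [|a u w Pu Pw|g i _]; first by rewrite linear0l.
  by rewrite linearPl; apply: PL.
elim/HD_span_lin: v => [|a v w Pv Pw|h j _]; first by rewrite linear0r.
  by rewrite linearPr; apply: PL.
exact: Pb.
Qed.

Lemma iter_tauM i u v : iter i tau (u * v) = iter i tau u * iter i tau v.
Proof. by elim: i => //= i ->; rewrite HD_scalM //; apply: qW. Qed.

Lemma iter_tau_eps i u : eps (iter i tau u) = eps u.
Proof. by elim: i => //= i IHi; rewrite HD_eps_scal. Qed.

Lemma iter_tau_Delta i u :
  Delta (iter i tau u) = tmap (iter i tau) (iter i tau) (Delta u).
Proof.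
elim: i => [|i IHi] /=.
  elim/tens_ind: (Delta u) => [v w||s t {1}-> {1}->]; first by rewrite tmapE.
    by rewrite linear0.
  by rewrite linearD.
rewrite HD_Delta_scal IHi.
elim/tens_ind: (Delta u) => [v w||s t es et]; first by rewrite !tmapE.
  by rewrite !linear0.
by rewrite !linearD /= es et.
Qed.

Lemma HD_cr u h j : c (u \ox b h j) = b h j \ox iter j tau u.
Proof. by rewrite HD_braidEr //; apply: qW. Qed.

Lemma HD_cl g i v : c (b g i \ox v) = iter i tau v \ox b g i.
Proof. by rewrite HD_braidEl //; apply: qW. Qed.

Lemma HD_c g i h j : c (b g i \ox b h j) = q ^+ (i * j) *: (b h j \ox b g i).
Proof. by rewrite HD_braidE //; apply: qW. Qed.

Lemma HD_c_bij : bijective c.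
Proof.
have qVW : deg_weight q^-1 by apply: hd_lam_qVX.
exists (HD_braid q^-1) => t; elim/HD_tens_span: t => [|a s t es et|g i h j].
- by rewrite !linear0.
- by rewrite !linearP /= es et.
- rewrite HD_c linearZ /= HD_braidE // mulnC scalerA exprVn mulfV ?scale1r //.
  by rewrite expf_neq0 // hd_q_neq0.
- by rewrite !linear0.
- by rewrite !linearP /= es et.
rewrite HD_braidE // linearZ /= HD_c mulnC scalerA exprVn mulVf ?scale1r //.
by rewrite expf_neq0 // hd_q_neq0.
Qed.

(** With monomials of degrees [i] and [j] in the first two places, both sides reverse the factors,
    apply [tau] to the third one [i + j] times, and scale by [q ^+ (i * j)]. *)
Lemma HD_c_braid : braid_equation c.
Proof.
move=> t0; elim/tens_ind: t0 => [t w||s t es et]; last 2 first.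
- by rewrite !linear0.
- by rewrite !linearD /= es et.
elim/HD_tens_span: t => [|a s t es et|g i h j].
- by rewrite linear0l !linear0.
- by rewrite linearPl !linearP /= es et.
rewrite !(tmapE, HD_c, on23E, HD_cl, linearZl_LR, linearZ, assocIE) /=.
by rewrite on23E HD_cl assocIE tmapE HD_cl -!iterD addnC.
Qed.

Lemma HD_c_algl : compat_algl c.
Proof.
split=> [w|]; first by rewrite -HD_mon10 HD_cl.
move=> t0; elim/tens_ind: t0 => [t w||s t es et]; last 2 first.
- by rewrite !linear0.
- by rewrite !linearD /= es et.
elim/tens_ind: t => [u v||s t es et]; last 2 first.
- by rewrite linear0l !linear0.
- by rewrite linearDl !linearD /= es et.
elim/HD_span_lin: w => [|a w w' ew ew'|h j _].
- by rewrite linear0r !linear0.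
- by rewrite linearPr !linearP /= ew ew'.
rewrite !(tmapE, mulmapE, HD_cr, on23E, assocIE, assocE) /=.
by rewrite iter_tauM.
Qed.

Lemma HD_c_algr : compat_algr c.
Proof.
split=> [w|]; first by rewrite -HD_mon10 HD_cr.
move=> t0; elim/tens_ind: t0 => [t w||s t es et]; last 2 first.
- by rewrite !linear0.
- by rewrite !linearD /= es et.
elim/tens_ind: t => [u v||s t es et]; last 2 first.
- by rewrite linear0l !linear0.
- by rewrite linearDl !linearD /= es et.
elim/HD_span_lin: u => [|a u u' eu eu'|g i _].
- by rewrite !linear0l !linear0.
- by rewrite !linearPl !linearP /= eu eu'.
rewrite !(tmapE, mulmapE, HD_cl, on23E, assocIE, assocE) /=.
by rewrite iter_tauM.
Qed.

Lemma HD_c_coalgl : compat_coalgl Delta eps c.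
Proof.
split=> t0; elim/tens_ind: t0 => [v w||s t es et].
- elim/HD_span_lin: w => [|a w w' ew ew'|h j _].
  + by rewrite linear0r !linear0.
  + by rewrite linearPr !linearP /= ew ew'.
  by rewrite HD_cr !tmapE lunitE runitE /= iter_tau_eps.
- by rewrite !linear0.
- by rewrite !linearD /= es et.
- elim/HD_span_lin: w => [|a w w' ew ew'|h j _].
  + by rewrite linear0r !linear0.
  + by rewrite linearPr !linearP /= ew ew'.
  rewrite HD_cr !tmapE /= iter_tau_Delta.
  elim/tens_ind: (Delta v) => [v1 v2||s t es et].
  + by rewrite on23E HD_cr tmapE !assocIE tmapE /= HD_cr.
  + by rewrite linear0 linear0r linear0l !linear0.
  by rewrite linearD linearDr linearDl !linearD /= es et.
- by rewrite !linear0.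
- by rewrite !linearD /= es et.
Qed.

Lemma HD_c_coalgr : compat_coalgr Delta eps c.
Proof.
split=> t0; elim/tens_ind: t0 => [w v||s t es et].
- elim/HD_span_lin: w => [|a w w' ew ew'|h j _].
  + by rewrite linear0l !linear0.
  + by rewrite linearPl !linearP /= ew ew'.
  by rewrite HD_cl !tmapE lunitE runitE /= iter_tau_eps.
- by rewrite !linear0.
- by rewrite !linearD /= es et.
- elim/HD_span_lin: w => [|a w w' ew ew'|h j _].
  + by rewrite linear0l !linear0.
  + by rewrite linearPl !linearP /= ew ew'.
  rewrite HD_cl !tmapE /= iter_tau_Delta.
  elim/tens_ind: (Delta v) => [v1 v2||s t es et].
  + by rewrite assocIE !tmapE /= HD_cl on23E HD_cl assocIE.
  + by rewrite linear0 linear0r linear0l !linear0.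
  by rewrite linearD linearDr linearDl !linearD /= es et.
- by rewrite !linear0.
- by rewrite !linearD /= es et.
Qed.

(** * The braided tensor square and multiplicativity of the comultiplication *)

Definition bprod (t s : H ⊗ H) : H ⊗ H :=
  tmap (mulmap H) (mulmap H) (middle c (t \ox s)).

Lemma bprodE u v g i w :
  bprod (u \ox v) (b g i \ox w) = (u * b g i) \ox (iter i tau v * w).
Proof.
by rewrite /bprod /middle assocIE tmapE /= on23E HD_cr assocIE assocE tmapE !mulmapE.
Qed.

Fact bprod_is_bilinear : bilinear_for *:%R *:%R bprod.
Proof.
apply: bilinear_forI => [a s s' t|a s t t']; rewrite /bprod /middle.
  by rewrite linearPl !linearP.
by rewrite linearPr !linearP.
Qed.
HB.instance Definition _ := bilinear_isBilinear.Build k (H ⊗ H) (H ⊗ H) (H ⊗ H)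
  *:%R *:%R bprod bprod_is_bilinear.

Lemma bprod_grp t g : bprod t (gr g \ox gr g) = tmap (rmul (gr g)) (rmul (gr g)) t.
Proof.
elim/tens_ind: t => [u v||s t es et].
- by rewrite -{1}HD_mon0 bprodE tmapE HD_mon0.
- by rewrite linear0l linear0.
by rewrite linearDl linearD /= es et.
Qed.

(** An instance of associativity in the braided tensor square, where [shiftx] is right
    multiplication by the coproduct of [x]. *)
Lemma bprod_shiftx t s : bprod t (shiftx s) = shiftx (bprod t s).
Proof.
elim/tens_ind: t => [u v||t t' et et']; last 2 first.
- by rewrite !linear0l linear0.
- by rewrite !linearDl linearD /= et et'.
elim/tens_ind: s => [u' w||s s' es es']; last 2 first.
- by rewrite linear0 !linear0r linear0.
- by rewrite linearD !linearDr linearD /= es es'.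
elim/HD_span_lin: u' => [|a u' u'' e e'|g i _].
- by rewrite linear0l linear0 linear0r linear0.
- by rewrite linearPl linearP !linearPr linearP /= e e'.
rewrite shiftxE linearDr /= -HD_monS !bprodE shiftxE HD_monS !mulrA.
by rewrite !zscalE HD_scalM ?mulrA //; apply: qW.
Qed.

Lemma HD_DeltaM t : Delta (mulmap H t) =
  tmap (mulmap H) (mulmap H) (middle c (tmap Delta Delta t)).
Proof.
elim/tens_ind: t => [u v||s t es et]; last 2 first.
- by rewrite /middle !linear0.
- by move: es et; rewrite /middle !linearD /= => -> ->.
rewrite mulmapE tmapE /= -/(bprod _ _).
(* Induction on the right factor leaves only right multiplication by group elements and by [x]. *)
elim/HD_gen_ind: v => [|a v w ev ew|g|v ev].
- by rewrite mulr0 !linear0 linear0r.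
- by rewrite mulrDr -scalerAr !linearP /= ev ew linearPr.
- by rewrite HD_DeltaMg HD_Deltag bprod_grp.
by rewrite mulrA !HD_DeltaMx ev bprod_shiftx.
Qed.

Lemma HD_bialgebra : is_braided_bialgebra Delta eps c.
Proof.
split.
- by split; [apply: HD_coassoc | apply: HD_counitl | apply: HD_counitr].
- exact: HD_c_bij.
- exact: HD_c_braid.
- exact: HD_c_algl.
- exact: HD_c_algr.
- exact: HD_c_coalgl.
- exact: HD_c_coalgr.
- by rewrite -HD_grp1 /= HD_Deltag.
- by rewrite -HD_grp1 /= HD_epsg.
- exact: HD_epsM.
exact: HD_DeltaM.
Qed.

(** * The antipode *)

Definition anti_coef (i : nat) : k := (-1) ^+ i * Q ^+ (i * i.-1)./2.

Lemma anti_coefS i : anti_coef i.+1 = - Q ^+ i * anti_coef i.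
Proof. by rewrite /anti_coef -!bin2 binS bin1 exprD !exprS; ring. Qed.

(** In this form the coefficient is the value at 0 of a product of linear factors with roots the
    powers of [Q]. *)
Lemma anti_coef_prod m : anti_coef m = \prod_(0 <= i < m) - Q ^+ i.
Proof.
elim: m => [|m IHm]; first by rewrite big_nil /anti_coef mulr1.
by rewrite big_nat_recr //= -IHm anti_coefS mulrC.
Qed.

(* Evaluate X^n - 1 = \prod_i (X - Q^i) at 0. *)
Lemma anti_coef_n : anti_coef n = -1.
Proof.
have /(congr1 (fun p => p.[0])) := factor_Xn_sub_1 (hd_qchi_order D).
rewrite horner_prod hornerD hornerXn expr0n eqn0Ngt hd_n_gt0 hornerN hornerC add0r.
move=> <-; rewrite anti_coef_prod; apply: eq_bigr => i _.
by rewrite hornerXsubC sub0r.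
Qed.

Lemma anti_coef_wrap i : anti_coef (i + n) = - anti_coef i.
Proof.
elim: i => [|i IHi]; first by rewrite anti_coef_n /anti_coef mulr1.
rewrite addSn !anti_coefS IHi exprD (prim_expr_order (hd_qchi_order D)).
by rewrite mulr1 mulrN.
Qed.

Definition HD_S : H -> H := HD_ext (fun g i =>
  anti_coef i *: (x ^+ i * gr (z ^- i)%g * gr g^-1%g)).
HB.instance Definition _ := GRing.Linear.on HD_S.
Local Notation S := HD_S.

Lemma HD_SE g i :
  S (b g i) = anti_coef i *: (x ^+ i * gr (z ^- i)%g * gr g^-1%g).
Proof.
(* The sign from [anti_coef_wrap] is essential: minus [(z^n - 1) z^(-i-n)] is
   [z^(-n) z^(-i) - z^(-i)], and these two terms belong to [g z^n] and to [g]. *)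
rewrite [LHS]HD_extE // => {}g {}i; rewrite anti_coef_wrap exprD HD_xn.
rewrite -scalerAr -!scalerAl scalerA [- _ * _]mulrC -scalerA; congr (_ *: _).
rewrite scaleNr -scalerBr -scalerN; congr (_ *: _).
rewrite mulrBr mulr1 !mulrBl opprB -!mulrA -!HD_grpM.
rewrite invMg -expgVn; congr (_ * gr _ - _ * gr _).
  by rewrite -!expgVn mulgA -expgD addnC.
by rewrite -!expgVn addnC expgD !mulgA (expgVn z n) mulgV mul1g.
Qed.

Lemma HD_Sg g : S (gr g) = gr g^-1%g.
Proof.
by rewrite -HD_mon0 HD_SE /anti_coef expr0 invg1 HD_grp1 !mul1r scale1r.
Qed.

Lemma HD_zVx i : gr z^-1%g * x ^+ i = chi z ^+ i *: (x ^+ i * gr z^-1%g).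
Proof. by rewrite HD_xXg scalerA -exprMn -hd_chiM mulgV hd_chi1 expr1n scale1r. Qed.

(** Braided antimultiplicativity: [tau] accounts for moving [x] past [u], and [- (x * gr z^-1)] is
    the value of [S] at [x]. *)
Lemma HD_SMx u : S (u * x) = - (x * gr z^-1%g * S (tau u)).
Proof.
elim/HD_span_lin: u => [|a u v eu ev|g i _].
- by rewrite mul0r !linear0 mulr0 oppr0.
- by rewrite mulrDl -scalerAl !linearP /= eu ev mulrDr -scalerAr opprD scalerN.
rewrite -HD_monS HD_scalE; last exact: qW.
rewrite linearZ /= !HD_SE -!scalerAr !scalerA -scaleNr -!mulrA.
(* The factor [q ^+ i] from [tau] and [chi z ^+ i] from moving the inverse of [z] past [x ^+ i]
   combine to the [Q ^+ i] of [anti_coefS]. *)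
rewrite [gr z^-1%g * (x ^+ i * _)]mulrA HD_zVx -scalerAl -scalerAr scalerA.
rewrite -!mulrA -!HD_grpM [x * _]mulrA -exprS anti_coefS exprMn.
congr (_ *: (_ * gr _)); first by ring.
by rewrite -!expgVn expgS !mulgA.
Qed.

Lemma HD_SMz u : S (u * gr z) = gr z^-1%g * S u.
Proof.
elim/HD_span_lin: u => [|a u v eu ev|g i _].
- by rewrite mul0r !linear0 mulr0.
- by rewrite mulrDl -scalerAl !linearP /= eu ev mulrDr -scalerAr.
have -> : b g i * gr z = chi z ^+ i *: b (g * z)%g i.
  by rewrite -HD_mon0 HD_monM addn0.
rewrite linearZ /= !HD_SE -scalerAr scalerA mulrC -scalerA; congr (_ *: _).
rewrite -!mulrA [gr z^-1%g * _]mulrA HD_zVx -scalerAl -!mulrA -!HD_grpM.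
congr (_ *: (_ * gr _)).
by rewrite invMg -!expgVn !mulgA -expgSr -expgS.
Qed.

Lemma HD_antipode : is_antipode Delta eps S.
Proof.
split=> h; last first.
  elim/HD_gen_ind: h => [|a u v eu ev|g|u _].
  - by rewrite !linear0 scale0r.
  - by rewrite !linearP /= eu ev scalerDl scalerA.
  - by rewrite /= HD_Deltag tmapE mulmapE /= HD_Sg HD_epsg -HD_grpM mulgV HD_grp1 scale1r.
  rewrite /= HD_DeltaMx HD_epsMx scale0r.
  elim/tens_ind: (Delta u) => [v w||s t es et]; last 2 first.
  - by rewrite !linear0.
  - by rewrite !linearD /= es et addr0.
  (* For this side the two summands of [shiftx] cancel on every pure tensor, without an induction
     hypothesis. *)
  rewrite shiftxE !linearD /= !tmapE !mulmapE /= zscalE HD_SMx HD_SMz.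
  by rewrite mulrN !mulrA addNr.
elim/HD_span_lin: h => [|a u v eu ev|g i _].
- by rewrite !linear0 scale0r.
- by rewrite !linearP /= eu ev scalerDl scalerA.
(* On this side the recursion involves the value at [tau u], which reduces to that at [u] when [u]
   is a monomial; hence an explicit induction on the degree. *)
elim: i => [|i IHi].
  rewrite HD_mon0 /= HD_Deltag tmapE mulmapE /= HD_Sg HD_epsg -HD_grpM.
  by rewrite mulVg HD_grp1 scale1r.
have shift t : mulmap H (tmap S idfun (shiftx t)) = mulmap H (tmap S idfun t) * x -
    x * gr z^-1%g * mulmap H (tmap S idfun (tmap tau tau t)) * gr z.
  elim/tens_ind: t => [v w||s t es et]; last 2 first.
  - by rewrite !linear0 mul0r mulr0 mul0r subr0.
  - by rewrite !linearD /= es et mulrDl mulrDr mulrDl opprD addrACA.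
  rewrite shiftxE !linearD /= !tmapE !mulmapE /= zscalE HD_SMx.
  by rewrite mulNr !mulrA.
rewrite HD_monS /= HD_DeltaMx HD_epsMx shift -HD_Delta_scal HD_scalE; last exact: qW.
rewrite !linearZ /= IHi !scalerA -!scalerAr -!scalerAl.
rewrite mul1r mulr1 -mulrA -HD_grpM mulVg HD_grp1 mulr1 scale0r.
(* In degree 0 the two terms cancel since [q ^+ 0 = 1]; in positive degree the counit makes both
   vanish. *)
rewrite /= HD_epsE; case: i {IHi} => [|i]; first by rewrite expr0 mul1r subrr.
by rewrite mulr0 !scale0r subrr.
Qed.

Lemma HD_hopf : is_braided_hopf Delta eps c S.
Proof. by split; [apply: HD_bialgebra | apply: HD_antipode]. Qed.

(** * Uniqueness of the structure *)

Lemma HD_bialgebra_uniq (Delta' : {linear H -> H ⊗ H}) (eps' : {linear H -> k^o})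
    (c' : {linear H ⊗ H -> H ⊗ H}) :
  is_braided_bialgebra Delta' eps' c' ->
  (forall g, Delta' (gr g) = gr g \ox gr g) -> (forall g, eps' (gr g) = 1) ->
  Delta' x = 1 \ox x + x \ox gr z -> eps' x = 0 ->
  (forall g h i j, c' (b g i \ox b h j) = q ^+ (i * j) *: (b h j \ox b g i)) ->
  [/\ Delta' =1 Delta, eps' =1 eps & c' =1 c].
Proof.
move=> bb' Dg eg Dx ex cb.
have cE : c' =1 c.
  elim/HD_tens_span=> [|a s t es et|g i h j]; first by rewrite !linear0.
    by rewrite !linearP es et.
  by rewrite cb HD_c.
(* The multiplicativity axiom of each structure involves its own braid, so the two braids are
   identified first. *)
have middleE t : middle c' t = middle c t.
  rewrite /middle; congr (assoc _); apply: tmap_eq => // s.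
  by rewrite /= /on23; congr (assocI _); apply: tmap_eq.
split=> // u.
  elim/HD_gen_ind: u => [|a u v eu ev|g|u eu]; first by rewrite !linear0.
  - by rewrite !linearP eu ev.
  - by rewrite Dg HD_Deltag.
  rewrite -mulmapE (bb_DeltaM bb') HD_DeltaM middleE !tmapE /=.
  by rewrite eu Dx HD_Deltax.
elim/HD_gen_ind: u => [|a u v eu ev|g|u eu]; first by rewrite !linear0.
- by rewrite !linearP eu ev.
- by rewrite eg HD_epsg.
by rewrite (bb_epsM bb') ex mulr0 HD_epsMx.
Qed.

End HopfDatum.

Theorem corollary2p8 (k : fieldType) (G : finGroupType) (D : hopf_datum k G) :
  (exists (Delta : {linear HD D -> HD D ⊗ HD D}) (eps : {linear HD D -> k^o})
      (c : {linear HD D ⊗ HD D -> HD D ⊗ HD D}) (S : {linear HD D -> HD D}),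
    let coalgebra_values (Delta' : {linear HD D -> HD D ⊗ HD D})
        (eps' : {linear HD D -> k^o}) :=
      [/\ forall g, Delta' (HD_grp D g) = HD_grp D g \ox HD_grp D g,
          forall g, eps' (HD_grp D g) = 1,
          Delta' (HD_x D) = 1 \ox HD_x D + HD_x D \ox HD_grp D (hd_z D)
        & eps' (HD_x D) = 0] in
    let braid_values (c' : {linear HD D ⊗ HD D -> HD D ⊗ HD D}) :=
      forall (g h : G) (i j : nat),
        c' ((HD_grp D g * HD_x D ^+ i) \ox (HD_grp D h * HD_x D ^+ j)) =
        hd_q D ^+ (i * j) *:
          ((HD_grp D h * HD_x D ^+ j) \ox (HD_grp D g * HD_x D ^+ i)) in
    [/\ is_braided_hopf Delta eps c S,
        coalgebra_values Delta eps,
        braid_values c,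
        forall (g : G) (i : nat),
          S (HD_grp D g * HD_x D ^+ i) =
          ((-1) ^+ i * (hd_q D * hd_chi D (hd_z D)) ^+ (i * i.-1)./2) *:
            (HD_x D ^+ i * HD_grp D (hd_z D ^- i)%g * HD_grp D g^-1%g)
      & forall (Delta' : {linear HD D -> HD D ⊗ HD D})
            (eps' : {linear HD D -> k^o})
            (c' : {linear HD D ⊗ HD D -> HD D ⊗ HD D}),
          is_braided_bialgebra Delta' eps' c' ->
          coalgebra_values Delta' eps' -> braid_values c' ->
          [/\ Delta' =1 Delta, eps' =1 eps & c' =1 c]]) /\
  is_basis (fun p : G * 'I_(hd_n D) => HD_grp D p.1 * HD_x D ^+ p.2) /\
  has_dim (HD D) (hd_n D * #|G|).
Proof.
split; last first.
  split; first exact: HD_basis.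
  by have := is_basis_dim (HD_basis D); rewrite card_prod card_ord mulnC.
exists (@HD_Delta k G D), (@HD_eps k G D), (HD_braid D (hd_q D)), (@HD_S k G D).
move=> cv bv; split.
- exact: HD_hopf.
- split; [exact: HD_Deltag | exact: HD_epsg | exact: HD_Deltax |].
  by rewrite -[HD_x D]mul1r /= HD_epsMx.
- by move=> g h i j; apply: HD_c.
- by move=> g i; apply: HD_SE.
move=> Delta' eps' c' bb' [Dg eg Dx ex] cb.
exact: HD_bialgebra_uniq.
Qed.
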